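(* Let $\mu\in\mathbb{R}$ and let $\gamma:[0,L]\to\mathbb{R}^3$ be an arclength parametrized Frenet curve with curvature $\kappa$, torsion $\tau$, modified torsion $\lambda=\tau/\kappa$ and Frenet frame $T,N,B$. Then the strip $F_\gamma$ is elastic (with Lagrange multiplier $\mu$) if and only if the force vector $$b_0=a_1T+a_2N+a_3B$$ is constant along $\gamma$, where $$a_1:=\tfrac12\left(\kappa^2(1+\lambda^2)^2+\mu\right),$$ $$a_2:=\kappa'(1+\lambda^2)^2+2\kappa(1+\lambda^2)\lambda\lambda',$$ $$a_3:=-\left(\kappa^2(1+\lambda^2)^2\lambda+\left(\tfrac{\kappa'}{\kappa}(1+\lambda^2)2\lambda\right)'+\left((1+\lambda^2)2\lambda\right)''\right),$$ and $'$ denotes the derivative with respect to arclength.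
   Context: All curves and variations are smooth ($C^\infty$). A Frenet curve is a regular curve $\gamma:[0,L]\to\mathbb{R}^3$ with nowhere vanishing curvature. Write $v=|\gamma'|$, $\kappa=|\gamma'\times\gamma''|/|\gamma'|^3$, $\tau=\det(\gamma',\gamma'',\gamma''')/|\gamma'\times\gamma''|^2$, and $\lambda=\tau/\kappa$ (the modified torsion). The Frenet frame $(T,N,B)$ satisfies $\gamma'=vT$, $T'=v\kappa N$, $N'=-v\kappa T+v\lambda\kappa B$, $B'=-v\lambda\kappa N$. The (rectifying) strip defined by $\gamma$ is the ruled surface $F_\gamma(t,u)=\gamma(t)+u\,(\lambda(t)T(t)+B(t))$, with $t\in[0,L]$ and $|u|\le\epsilon$. For $\mu\in\mathbb{R}$ (the Lagrange multiplier of the length constraint) the modified Sadowsky functional is $$S_\mu(\gamma)=\int_0^L\left(\kappa^2(1+\lambda^2)^2-\mu\right)v\,dt.$$ The strip $F_\gamma$ is elastic (equivalently, $\gamma$ defines an elastic strip) with Lagrange multiplier $\mu$ if $\gamma$ is a critical point of $S_\mu$, i.e. $\frac{d}{dt}\big|_{t=0}S_\mu(\gamma_t)=0$ for every proper variation of $\gamma$, a proper variation being a smooth family of Frenet curves $\gamma_t$ with $\gamma_0=\gamma$ and $\gamma_t=\gamma$ near both end points. *)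

(* Defs.v *)
From Stdlib Require Import Reals.
From Coquelicot Require Import Coquelicot.
Open Scope R_scope.

Definition vec : Type := (R * R * R)%type.

Definition cx (a : vec) : R := fst (fst a).
Definition cy (a : vec) : R := snd (fst a).
Definition cz (a : vec) : R := snd a.

Definition vzero : vec := (0, 0, 0).
Definition vadd (a b : vec) : vec := (cx a + cx b, cy a + cy b, cz a + cz b).
Definition vscale (r : R) (a : vec) : vec := (r * cx a, r * cy a, r * cz a).
Definition dot (a b : vec) : R := cx a * cx b + cy a * cy b + cz a * cz b.
Definition vnorm (a : vec) : R := sqrt (dot a a).
Definition cross (a b : vec) : vec :=
  (cy a * cz b - cz a * cy b,
   cz a * cx b - cx a * cz b,
   cx a * cy b - cy a * cx b).
Definition det3 (a b c : vec) : R := dot (cross a b) c.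

(* A curve [0,L] -> R^3 is represented by a total function; only its values on
   (a neighbourhood of) [0,L] are ever used. *)
Definition curve : Type := R -> vec.

Definition curve_deriv (n : nat) (c : curve) (s : R) : vec :=
  (Derive_n (fun r => cx (c r)) n s,
   Derive_n (fun r => cy (c r)) n s,
   Derive_n (fun r => cz (c r)) n s).

Definition speed (c : curve) (s : R) : R := vnorm (curve_deriv 1 c s).

Definition curvature (c : curve) (s : R) : R :=
  vnorm (cross (curve_deriv 1 c s) (curve_deriv 2 c s)) / speed c s ^ 3.

Definition torsion (c : curve) (s : R) : R :=
  det3 (curve_deriv 1 c s) (curve_deriv 2 c s) (curve_deriv 3 c s)
  / vnorm (cross (curve_deriv 1 c s) (curve_deriv 2 c s)) ^ 2.

Definition mod_torsion (c : curve) (s : R) : R := torsion c s / curvature c s.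

Definition tangent (c : curve) (s : R) : vec :=
  vscale (/ speed c s) (curve_deriv 1 c s).

Definition binormal (c : curve) (s : R) : vec :=
  vscale (/ vnorm (cross (curve_deriv 1 c s) (curve_deriv 2 c s)))
         (cross (curve_deriv 1 c s) (curve_deriv 2 c s)).

Definition normal (c : curve) (s : R) : vec :=
  cross (binormal c s) (tangent c s).

(* Smoothness on the closed interval [0,L] means smoothness on an open interval
   containing it, so that [Derive] at the end points 0 and L is the one-sided
   derivative of the restriction to [0,L]. *)
Definition smooth_curve (L : R) (c : curve) : Prop :=
  exists e : R, 0 < e /\
    forall (n : nat) (s : R), - e < s < L + e ->
      ex_derive_n (fun r => cx (c r)) n s /\
      ex_derive_n (fun r => cy (c r)) n s /\
      ex_derive_n (fun r => cz (c r)) n s.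

Definition frenet_curve (L : R) (c : curve) : Prop :=
  smooth_curve L c /\
  forall s : R, 0 <= s <= L -> curve_deriv 1 c s <> vzero /\ curvature c s <> 0.

Definition arclength_parametrized (L : R) (c : curve) : Prop :=
  forall s : R, 0 <= s <= L -> speed c s = 1.

(* Joint smoothness of (t, s) |-> G t s on (-d, d) x [0,L], again meaning
   smoothness on an open neighbourhood (-d, d) x (-e, L + e). *)
Definition smooth_family (d L : R) (G : R -> curve) : Prop :=
  exists e : R, 0 < e /\
    forall (n : nat) (t s : R), Rabs t < d -> - e < s < L + e ->
      ex_diff_n (fun t' s' => cx (G t' s')) n t s /\
      ex_diff_n (fun t' s' => cy (G t' s')) n t s /\
      ex_diff_n (fun t' s' => cz (G t' s')) n t s.

Definition proper_variation (L : R) (c : curve) (G : R -> curve) : Prop :=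
  exists d : R, 0 < d /\
    smooth_family d L G /\
    (forall t : R, Rabs t < d -> frenet_curve L (G t)) /\
    (forall s : R, 0 <= s <= L -> G 0 s = c s) /\
    (exists eta : R, 0 < eta /\
       forall t s : R, Rabs t < d -> 0 <= s <= L -> s <= eta \/ L - eta <= s ->
         G t s = c s).

Definition sadowsky (mu L : R) (c : curve) : R :=
  RInt (fun s =>
    (curvature c s ^ 2 * (1 + mod_torsion c s ^ 2) ^ 2 - mu) * speed c s) 0 L.

(* Elasticity of the strip F(s,u) = c(s) + u (lambda(s) T(s) + B(s)) is by
   definition a condition on its directrix c: criticality for [sadowsky mu L]. *)
Definition elastic_strip (mu L : R) (c : curve) : Prop :=
  forall G : R -> curve, proper_variation L c G ->
    is_derive (fun t => sadowsky mu L (G t)) 0 0.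

(* The derivatives below are with respect to the parameter of c, hence with
   respect to arclength when c is arclength parametrized. *)
Definition force1 (mu : R) (c : curve) (s : R) : R :=
  / 2 * (curvature c s ^ 2 * (1 + mod_torsion c s ^ 2) ^ 2 + mu).

Definition force2 (c : curve) (s : R) : R :=
  Derive (curvature c) s * (1 + mod_torsion c s ^ 2) ^ 2
  + 2 * curvature c s * (1 + mod_torsion c s ^ 2)
    * mod_torsion c s * Derive (mod_torsion c) s.

Definition force3 (c : curve) (s : R) : R :=
  - (curvature c s ^ 2 * (1 + mod_torsion c s ^ 2) ^ 2 * mod_torsion c s
     + Derive (fun r => Derive (curvature c) r / curvature c r
                        * ((1 + mod_torsion c r ^ 2) * (2 * mod_torsion c r))) s
     + Derive_n (fun r => (1 + mod_torsion c r ^ 2) * (2 * mod_torsion c r)) 2 s).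

Definition force_vector (mu : R) (c : curve) (s : R) : vec :=
  vadd (vadd (vscale (force1 mu c s) (tangent c s))
             (vscale (force2 c s) (normal c s)))
       (vscale (force3 c s) (binormal c s)).

(* Main.v *)
Require Import Defs.
From Stdlib Require Import Reals Lra Lia.
From Coquelicot Require Import Coquelicot.
Open Scope R_scope.

(* In terms of p = |c'|^2, q = |c' x c''|^2 and w = det(c', c'', c''') the integrand is
   (q / p^3 (1 + w^2 p^3 / q^3)^2 - mu) sqrt p, which involves only derivatives of c.
   Varying c with velocity V and integrating by parts in the Frenet frame, the first
   variation of the functional becomes the integral of 2 b'.V, where b is the force
   vector. Hence a constant b makes it vanish; conversely, if b'(s0) is not 0, the
   variation c + t phi b'(s0) with a bump function phi around s0 has a nonzero first
   variation. *)

(** * Smooth functions of two variables *)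

(** The integrand sees the curve only through its derivatives, so it is invariant under translations
    and its Euler-Lagrange equation is a total derivative: it reads b' = 0, where -2b is the
    momentum conserved by this symmetry. This is where the factor 2 comes from and why criticality
    amounts to a constant vector. Frame, curvature and torsion of the varied curves are never
    differentiated in t. In the variables p, q, w the t-derivative only needs t- and s-derivatives
    to commute, and the frame enters for the original curve alone, at unit speed. The obstacle lies
    at the end points. Derivatives are two-sided and smoothness holds on an open neighbourhood, but
    unit speed, the equality of [G 0] with the curve and the vanishing of the velocity near the ends
    are known inside the closed interval only. Identities that must be differentiated are therefore
    proved at interior points, and values at 0 and L are recovered by continuity. Nondegeneracy,
    being an open condition, extends to a neighbourhood, which provides the domains on which
    everything is smooth. *)

Definition open2 (U : R -> R -> Prop) : Prop :=
  forall t s, U t s -> locally_2d U t s.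

(** Functions of s alone are handled as families constant in t on a strip [fun _ s => I s], so that
    a single curve and a variation share the same closure lemmas. *)
Definition smooth2 (U : R -> R -> Prop) (f : R -> R -> R) : Prop :=
  forall (n : nat) (t s : R), U t s -> ex_diff_n f n t s.

Definition dt (f : R -> R -> R) (t s : R) : R := Derive (fun z => f z s) t.
Definition ds (f : R -> R -> R) (t s : R) : R := Derive (fun z => f t z) s.

Lemma open2_and (U V : R -> R -> Prop) :
  open2 U -> open2 V -> open2 (fun t s => U t s /\ V t s).
Proof. intros hU hV t s [h1 h2]; apply locally_2d_and; auto. Qed.

Lemma open2_gt_0 (U : R -> R -> Prop) (f : R -> R -> R) :
  open2 U -> (forall t s, U t s -> continuity_2d_pt f t s) ->
  open2 (fun t s => U t s /\ 0 < f t s).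
Proof.
  intros hU hf t s [h1 h2].
  apply locally_2d_and; [now apply hU|].
  generalize (hf t s h1 (mkposreal _ h2)); simpl.
  apply locally_2d_impl, locally_2d_forall; intros u v h.
  apply Rabs_def2 in h; lra.
Qed.

Lemma open2_abs_lt (d : R) : open2 (fun t _ => Rabs t < d).
Proof.
  intros t s h.
  assert (hp : 0 < d - Rabs t) by lra.
  exists (mkposreal _ hp); simpl; intros u v hu _.
  pose proof (Rabs_triang (u - t) t).
  replace (u - t + t) with u in * by ring; lra.
Qed.

Lemma open2_between (a b : R) : open2 (fun _ s => a < s < b).
Proof.
  intros t s h.
  assert (hp : 0 < Rmin (s - a) (b - s)) by (apply Rmin_glb_lt; lra).
  exists (mkposreal _ hp); simpl; intros u v _ hv.
  pose proof (Rmin_l (s - a) (b - s)); pose proof (Rmin_r (s - a) (b - s)).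
  apply Rabs_def2 in hv; lra.
Qed.

Lemma open2_locally_t (U : R -> R -> Prop) (t s : R) :
  open2 U -> U t s -> locally t (fun z => U z s).
Proof. intros hU h; exact (locally_2d_1d_const_y U t s (hU t s h)). Qed.

Lemma open2_locally_s (U : R -> R -> Prop) (t s : R) :
  open2 U -> U t s -> locally s (fun z => U t z).
Proof. intros hU h; exact (locally_2d_1d_const_x U t s (hU t s h)). Qed.

Section SmoothFunctions.

Variable U : R -> R -> Prop.
Hypothesis openU : open2 U.

Lemma smooth2_continuity f t s : smooth2 U f -> U t s -> continuity_2d_pt f t s.
Proof. intros hf h; exact (proj1 (hf 0%nat t s h)). Qed.

Lemma smooth2_ex_derive_t f t s :
  smooth2 U f -> U t s -> ex_derive (fun z => f z s) t.
Proof. intros hf h; apply (hf 1%nat t s h). Qed.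

Lemma smooth2_ex_derive_s f t s :
  smooth2 U f -> U t s -> ex_derive (fun z => f t z) s.
Proof. intros hf h; apply (hf 1%nat t s h). Qed.

Lemma smooth2_dt f : smooth2 U f -> smooth2 U (dt f).
Proof. intros hf n t s h; apply (hf (S n) t s h). Qed.

Lemma smooth2_ds f : smooth2 U f -> smooth2 U (ds f).
Proof. intros hf n t s h; apply (hf (S n) t s h). Qed.

Lemma smooth2_ext f g :
  (forall t s, U t s -> f t s = g t s) -> smooth2 U f -> smooth2 U g.
Proof.
  intros e hf n t s h; apply ex_diff_n_ext_loc with f; [|now apply hf].
  generalize (openU t s h); apply locally_2d_impl, locally_2d_forall; auto.
Qed.

(** Closure under operations goes by induction on the order: differentiating a product, an inverse
    or a root brings back the function itself, one order lower. *)
Definition Ck (n : nat) (f : R -> R -> R) : Prop :=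
  forall t s, U t s -> ex_diff_n f n t s.

Lemma Ck_ext n f g : (forall t s, U t s -> f t s = g t s) -> Ck n f -> Ck n g.
Proof.
  intros e hf t s h; apply ex_diff_n_ext_loc with f; [|now apply hf].
  generalize (openU t s h); apply locally_2d_impl, locally_2d_forall; auto.
Qed.

Lemma Ck_S n f : Ck (S n) f <->
  (forall t s, U t s -> continuity_2d_pt f t s) /\
  (forall t s, U t s -> ex_derive (fun z => f z s) t) /\
  (forall t s, U t s -> ex_derive (fun z => f t z) s) /\
  Ck n (dt f) /\ Ck n (ds f).
Proof.
  split.
  - intros hf; split; [|split; [|split; [|split]]]; intros t s h; apply (hf t s h).
  - intros (h0 & h1 & h2 & h3 & h4) t s h; simpl; split; [|split; [|split; [|split]]]; auto.
Qed.

Lemma Ck_pred n f : Ck (S n) f -> Ck n f.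
Proof.
  intros hf t s h; apply ex_diff_n_m with (S n); [lia|now apply hf].
Qed.

Lemma Ck_const n c : Ck n (fun _ _ => c).
Proof.
  revert c; induction n as [|n IH]; intros c.
  - intros t s _; split; [apply continuity_2d_pt_const|easy].
  - apply Ck_S; split; [|split; [|split; [|split]]]; intros.
    + apply continuity_2d_pt_const.
    + auto_derive; auto.
    + auto_derive; auto.
    + apply Ck_ext with (fun _ _ => 0); auto.
      intros; symmetry; exact (Derive_const _ _).
    + apply Ck_ext with (fun _ _ => 0); auto.
      intros; symmetry; exact (Derive_const _ _).
Qed.

Lemma Ck_time n : Ck n (fun t _ => t).
Proof.
  destruct n as [|n].
  - intros t s _; split; [apply continuity_2d_pt_id1|easy].
  - apply Ck_S; split; [|split; [|split; [|split]]]; intros.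
    + apply continuity_2d_pt_id1.
    + auto_derive; auto.
    + auto_derive; auto.
    + apply Ck_ext with (fun _ _ => 1); [|apply Ck_const].
      intros; symmetry; exact (Derive_id _).
    + apply Ck_ext with (fun _ _ => 0); [|apply Ck_const].
      intros; symmetry; exact (Derive_const _ _).
Qed.

Lemma Ck_plus n f g : Ck n f -> Ck n g -> Ck n (fun t s => f t s + g t s).
Proof.
  revert f g; induction n as [|n IH]; intros f g hf hg.
  - intros t s h; split; [|easy].
    apply continuity_2d_pt_plus; [apply (hf t s h)|apply (hg t s h)].
  - apply Ck_S in hf; apply Ck_S in hg.
    destruct hf as (f0 & f1 & f2 & f3 & f4), hg as (g0 & g1 & g2 & g3 & g4).
    apply Ck_S; split; [|split; [|split; [|split]]]; intros.
    + apply continuity_2d_pt_plus; auto.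
    + apply (ex_derive_plus (fun z => f z s) (fun z => g z s)); auto.
    + apply (ex_derive_plus (fun z => f t z) (fun z => g t z)); auto.
    + apply Ck_ext with (fun t s => dt f t s + dt g t s); auto.
      intros t s h; symmetry.
      apply (Derive_plus (fun z => f z s) (fun z => g z s)); auto.
    + apply Ck_ext with (fun t s => ds f t s + ds g t s); auto.
      intros t s h; symmetry.
      apply (Derive_plus (fun z => f t z) (fun z => g t z)); auto.
Qed.

Lemma Ck_mult n f g : Ck n f -> Ck n g -> Ck n (fun t s => f t s * g t s).
Proof.
  revert f g; induction n as [|n IH]; intros f g hf hg.
  - intros t s h; split; [|easy].
    apply continuity_2d_pt_mult; [apply (hf t s h)|apply (hg t s h)].
  - assert (hf' := Ck_pred _ _ hf); assert (hg' := Ck_pred _ _ hg).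
    apply Ck_S in hf; apply Ck_S in hg.
    destruct hf as (f0 & f1 & f2 & f3 & f4), hg as (g0 & g1 & g2 & g3 & g4).
    apply Ck_S; split; [|split; [|split; [|split]]]; intros.
    + apply continuity_2d_pt_mult; auto.
    + apply (ex_derive_mult (fun z => f z s) (fun z => g z s)); auto.
    + apply (ex_derive_mult (fun z => f t z) (fun z => g t z)); auto.
    + apply Ck_ext with (fun t s => dt f t s * g t s + f t s * dt g t s).
      2: now apply Ck_plus; apply IH.
      intros t s h; symmetry.
      apply (Derive_mult (fun z => f z s) (fun z => g z s)); auto.
    + apply Ck_ext with (fun t s => ds f t s * g t s + f t s * ds g t s).
      2: now apply Ck_plus; apply IH.
      intros t s h; symmetry.
      apply (Derive_mult (fun z => f t z) (fun z => g t z)); auto.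
Qed.

(** The derivative -f'/f^2 is a product of f' with two copies of 1/f, which the induction hypothesis
    already puts one order lower. *)
Lemma Ck_inv n f :
  (forall t s, U t s -> f t s <> 0) -> Ck n f -> Ck n (fun t s => / f t s).
Proof.
  intros nz; induction n as [|n IH]; intros hf.
  - intros t s h; split; [|easy].
    apply continuity_2d_pt_inv; [apply (hf t s h)|auto].
  - assert (hi := IH (Ck_pred _ _ hf)).
    apply Ck_S in hf; destruct hf as (f0 & f1 & f2 & f3 & f4).
    apply Ck_S; split; [|split; [|split; [|split]]]; intros.
    + apply continuity_2d_pt_inv; auto.
    + apply (ex_derive_inv (fun z => f z s)); auto.
    + apply (ex_derive_inv (fun z => f t z)); auto.
    + apply Ck_ext with (fun t s => (-1) * (dt f t s * (/ f t s * / f t s))).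
      2: now repeat apply Ck_mult; try apply Ck_const.
      intros t s h; unfold dt at 2.
      rewrite (Derive_inv (fun z => f z s)) by auto.
      unfold dt; field; auto.
    + apply Ck_ext with (fun t s => (-1) * (ds f t s * (/ f t s * / f t s))).
      2: now repeat apply Ck_mult; try apply Ck_const.
      intros t s h; unfold ds at 2.
      rewrite (Derive_inv (fun z => f t z)) by auto.
      unfold ds; field; auto.
Qed.

(** The derivative is f' times 1/(2 sqrt f); the second factor has order n by the induction
    hypothesis and [Ck_inv]. *)
Lemma Ck_sqrt n f :
  (forall t s, U t s -> 0 < f t s) -> Ck n f -> Ck n (fun t s => sqrt (f t s)).
Proof.
  intros pos; induction n as [|n IH]; intros hf.
  - intros t s h; split; [|easy].
    apply (continuity_1d_2d_pt_comp sqrt f); [|apply (hf t s h)].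
    apply continuity_pt_sqrt; left; auto.
  - assert (hi := IH (Ck_pred _ _ hf)).
    assert (hd : forall t s, U t s -> 2 * sqrt (f t s) <> 0).
    { intros t s h; pose proof (sqrt_lt_R0 _ (pos t s h)); lra. }
    assert (hj : Ck n (fun t s => / (2 * sqrt (f t s)))).
    { apply Ck_inv; auto; apply Ck_mult; [apply Ck_const|auto]. }
    apply Ck_S in hf; destruct hf as (f0 & f1 & f2 & f3 & f4).
    assert (d1 : forall t s, U t s -> is_derive (fun z => sqrt (f z s)) t
               (dt f t s * / (2 * sqrt (f t s)))).
    { intros t s h; apply (is_derive_sqrt (fun z => f z s)); auto.
      apply Derive_correct; auto. }
    assert (d2 : forall t s, U t s -> is_derive (fun z => sqrt (f t z)) s
               (ds f t s * / (2 * sqrt (f t s)))).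
    { intros t s h; apply (is_derive_sqrt (fun z => f t z)); auto.
      apply Derive_correct; auto. }
    apply Ck_S; split; [|split; [|split; [|split]]]; intros.
    + apply (continuity_1d_2d_pt_comp sqrt f); auto.
      apply continuity_pt_sqrt; left; auto.
    + eexists; apply d1; auto.
    + eexists; apply d2; auto.
    + apply Ck_ext with (fun t s => dt f t s * / (2 * sqrt (f t s))).
      2: now apply Ck_mult.
      intros t s h; symmetry; apply is_derive_unique; auto.
    + apply Ck_ext with (fun t s => ds f t s * / (2 * sqrt (f t s))).
      2: now apply Ck_mult.
      intros t s h; symmetry; apply is_derive_unique; auto.
Qed.

Lemma smooth2_const c : smooth2 U (fun _ _ => c).
Proof. intros n; apply Ck_const. Qed.

Lemma smooth2_time : smooth2 U (fun t _ => t).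
Proof. intros n; apply Ck_time. Qed.

Lemma smooth2_plus f g :
  smooth2 U f -> smooth2 U g -> smooth2 U (fun t s => f t s + g t s).
Proof. intros hf hg n; apply Ck_plus; [exact (hf n)|exact (hg n)]. Qed.

Lemma smooth2_mult f g :
  smooth2 U f -> smooth2 U g -> smooth2 U (fun t s => f t s * g t s).
Proof. intros hf hg n; apply Ck_mult; [exact (hf n)|exact (hg n)]. Qed.

Lemma smooth2_opp f : smooth2 U f -> smooth2 U (fun t s => - f t s).
Proof.
  intros hf; apply smooth2_ext with (fun t s => (-1) * f t s).
  - intros; ring.
  - apply smooth2_mult; [apply smooth2_const|easy].
Qed.

Lemma smooth2_minus f g :
  smooth2 U f -> smooth2 U g -> smooth2 U (fun t s => f t s - g t s).
Proof. intros hf hg; apply smooth2_plus; [|apply smooth2_opp]; easy. Qed.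

Lemma smooth2_inv f : (forall t s, U t s -> f t s <> 0) ->
  smooth2 U f -> smooth2 U (fun t s => / f t s).
Proof. intros nz hf n; apply Ck_inv; [easy|exact (hf n)]. Qed.

Lemma smooth2_div f g : (forall t s, U t s -> g t s <> 0) ->
  smooth2 U f -> smooth2 U g -> smooth2 U (fun t s => f t s / g t s).
Proof. intros nz hf hg; apply smooth2_mult; [|apply smooth2_inv]; easy. Qed.

Lemma smooth2_sqrt f : (forall t s, U t s -> 0 < f t s) ->
  smooth2 U f -> smooth2 U (fun t s => sqrt (f t s)).
Proof. intros pos hf n; apply Ck_sqrt; [easy|exact (hf n)]. Qed.

Lemma smooth2_pow f k : smooth2 U f -> smooth2 U (fun t s => f t s ^ k).
Proof.
  intros hf; induction k as [|k IH]; simpl.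
  - apply smooth2_const.
  - now apply smooth2_mult.
Qed.

Lemma smooth2_Derive_n f k :
  smooth2 U f -> smooth2 U (fun t s => Derive_n (f t) k s).
Proof.
  intros hf; induction k as [|k IH]; [exact hf|exact (smooth2_ds _ IH)].
Qed.

Lemma smooth2_ex_derive_n f k t s :
  smooth2 U f -> U t s -> ex_derive_n (f t) k s.
Proof.
  intros hf h; destruct k as [|k]; [easy|].
  exact (smooth2_ex_derive_s _ t s (smooth2_Derive_n f k hf) h).
Qed.

Lemma smooth2_dt_ds f t s :
  smooth2 U f -> U t s -> dt (ds f) t s = ds (dt f) t s.
Proof.
  intros hf h; apply Schwarz.
  - generalize (openU t s h); apply locally_2d_impl, locally_2d_forall.
    intros u v k; split; [|split; [|split]].
    + now apply smooth2_ex_derive_t.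
    + now apply smooth2_ex_derive_s.
    + exact (smooth2_ex_derive_t _ u v (smooth2_ds _ hf) k).
    + exact (smooth2_ex_derive_s _ u v (smooth2_dt _ hf) k).
  - exact (smooth2_continuity _ t s (smooth2_dt _ (smooth2_ds _ hf)) h).
  - exact (smooth2_continuity _ t s (smooth2_ds _ (smooth2_dt _ hf)) h).
Qed.

(** Schwarz's theorem moves the t-derivative past one s-derivative at a time. The induction
    hypothesis is used at all points near s, because it stands under a further derivative. *)
Lemma smooth2_dt_Derive_n f k t s : smooth2 U f -> U t s ->
  dt (fun t s => Derive_n (f t) k s) t s = Derive_n (dt f t) k s.
Proof.
  intros hf; revert s; induction k as [|k IH]; intros s h; [easy|].
  etransitivity.
  - exact (smooth2_dt_ds _ t s (smooth2_Derive_n f k hf) h).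
  - apply Derive_ext_loc; generalize (open2_locally_s U t s openU h).
    apply filter_imp; intros z hz; exact (IH z hz).
Qed.

End SmoothFunctions.

Lemma smooth2_sub (U V : R -> R -> Prop) f :
  (forall t s, V t s -> U t s) -> smooth2 U f -> smooth2 V f.
Proof. intros h hf n t s k; apply hf; auto. Qed.

Lemma smooth2_static (I : R -> Prop) (f : R -> R) :
  open2 (fun _ s => I s) ->
  (forall n s, I s -> ex_derive_n f n s) -> smooth2 (fun _ s => I s) (fun _ => f).
Proof.
  intros oI hf n.
  (* Differentiation in s replaces [f] by its derivative, so the induction on the order has to treat
     all [Derive_n f k] at once. *)
  assert (H : forall k, Ck (fun _ s => I s) n (fun _ => Derive_n f k)).
  2: exact (H 0%nat).
  induction n as [|n IH]; intros k.
  - intros t s h; split; [|easy].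
    apply (continuity_1d_2d_pt_comp (Derive_n f k) (fun _ s => s)).
    + apply continuity_pt_filterlim, (ex_derive_continuous (Derive_n f k)).
      exact (hf (S k) s h).
    + apply continuity_2d_pt_id2.
  - apply Ck_S; split; [|split; [|split; [|split]]]; intros.
    + apply (continuity_1d_2d_pt_comp (Derive_n f k) (fun _ s => s)).
      * apply continuity_pt_filterlim, (ex_derive_continuous (Derive_n f k)).
        exact (hf (S k) s H).
      * apply continuity_2d_pt_id2.
    + auto_derive; auto.
    + exact (hf (S k) s H).
    + apply Ck_ext with (fun _ _ => 0); [easy| |apply Ck_const; easy].
      intros; symmetry; exact (Derive_const _ _).
    + exact (IH (S k)).
Qed.

(** Lets a slice of a family, such as the velocity at time 0, be treated as a field along the fixed
    curve. *)
Lemma smooth2_at_time (U : R -> R -> Prop) (I : R -> Prop) (f : R -> R -> R) (t0 : R) :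
  open2 (fun _ s => I s) -> (forall s, I s -> U t0 s) -> smooth2 U f ->
  smooth2 (fun _ s => I s) (fun _ => f t0).
Proof.
  intros oI h hf; apply smooth2_static; [easy|].
  intros n s hs; apply (smooth2_ex_derive_n U); auto.
Qed.

(** * Bump functions *)

(** [flat 0] is the classical function exp(-1/x) extended by 0. The extra powers of 1/x make the
    family stable under differentiation, up to linear combinations. *)
Definition flat (n : nat) (x : R) : R :=
  if Rle_dec x 0 then 0 else exp (- / x) * (/ x) ^ n.

Lemma flat_neg n x : x <= 0 -> flat n x = 0.
Proof. intros h; unfold flat; destruct (Rle_dec x 0); [easy|lra]. Qed.

Lemma flat_pos n x : 0 < x -> flat n x = exp (- / x) * (/ x) ^ n.
Proof. intros h; unfold flat; destruct (Rle_dec x 0); [lra|easy]. Qed.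

Lemma flat_gt_0 n x : 0 < x -> 0 < flat n x.
Proof.
  intros h; rewrite flat_pos by easy; apply Rmult_lt_0_compat.
  - apply exp_pos.
  - apply pow_lt, Rinv_0_lt_compat; easy.
Qed.

(** With y = 1/x, the single Taylor term y^(n+1)/(n+1)! is at most exp y, hence exp(-y) y^n is at
    most (n+1)!/y. *)
Lemma flat_le n x : 0 < x -> flat n x <= INR (Factorial.fact (S n)) * x.
Proof.
  intros h; rewrite flat_pos by easy.
  assert (hy : 0 < / x) by now apply Rinv_0_lt_compat.
  assert (hf : 0 < INR (Factorial.fact (S n))) by apply INR_fact_lt_0.
  assert (H : (/ x) ^ S n / INR (Factorial.fact (S n)) <= exp (/ x)).
  { eapply Rle_trans; [|apply (exp_ge_taylor (/ x) (S n)); lra].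
    rewrite tech5.
    assert (0 <= sum_f_R0 (fun k => (/ x) ^ k / INR (Factorial.fact k)) n); [|lra].
    apply cond_pos_sum; intros k; apply Rlt_le, Rdiv_lt_0_compat.
    - now apply pow_lt.
    - apply INR_fact_lt_0. }
  rewrite exp_Ropp.
  assert (he := exp_pos (/ x)).
  apply Rmult_le_reg_l with (exp (/ x)); [easy|].
  replace (exp (/ x) * (/ exp (/ x) * (/ x) ^ n)) with ((/ x) ^ n) by (field; lra).
  apply Rmult_le_compat_r with (r := INR (Factorial.fact (S n)) * x) in H; [|nra].
  replace ((/ x) ^ S n / INR (Factorial.fact (S n)) * (INR (Factorial.fact (S n)) * x))
    with ((/ x) ^ n) in H; [lra|].
  rewrite <- tech_pow_Rmult; field; split; lra.
Qed.

Lemma is_derive_flat n x :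
  is_derive (flat n) x (flat (S (S n)) x - INR n * flat (S n) x).
Proof.
  destruct (Rtotal_order x 0) as [h|[h|h]].
  - rewrite !flat_neg by lra.
    apply is_derive_ext_loc with (fun _ => 0).
    + generalize (open_lt 0 x h); apply filter_imp; intros y hy.
      symmetry; apply flat_neg; lra.
    + replace (0 - INR n * 0) with 0 by ring; apply (is_derive_const 0).
  - subst x; rewrite !flat_neg by lra.
    apply is_derive_Reals; intros eps heps.
    assert (hf : 0 < INR (Factorial.fact (S (S n)))) by apply INR_fact_lt_0.
    (* For y > 0 the difference quotient at 0 is [flat n y / y], that is [flat (S n) y], which
       [flat_le] bounds by (n+2)! y; this dictates the radius. *)
    assert (hd : 0 < eps / INR (Factorial.fact (S (S n)))) by now apply Rdiv_lt_0_compat.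
    exists (mkposreal _ hd); intros y hy1 hy2; cbn [pos] in hy2.
    rewrite (flat_neg n 0), Rplus_0_l by lra.
    destruct (Rlt_dec 0 y) as [hy|hy].
    + replace ((flat n y - 0) / y - (0 - INR n * 0)) with (flat (S n) y).
      2: { rewrite !flat_pos by easy; simpl; field; lra. }
      rewrite Rabs_right by (apply Rle_ge, Rlt_le, flat_gt_0; easy).
      eapply Rle_lt_trans; [apply flat_le; lra|].
      rewrite Rabs_right in hy2 by lra.
      apply Rmult_lt_compat_l with (r := INR (Factorial.fact (S (S n)))) in hy2; [|easy].
      replace (INR (Factorial.fact (S (S n))) * (eps / INR (Factorial.fact (S (S n)))))
        with eps in hy2 by (field; lra). lra.
    + rewrite flat_neg by lra.
      replace ((0 - 0) / y - (0 - INR n * 0)) with 0 by (field; assumption).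
      now rewrite Rabs_R0.
  - rewrite !flat_pos by lra.
    apply is_derive_ext_loc with (fun y => exp (- / y) * (/ y) ^ n).
    + generalize (open_gt 0 x h); apply filter_imp; intros y hy.
      symmetry; apply flat_pos; lra.
    + assert (D : is_derive (fun y => / y) x (- / (x * x))).
      { auto_derive; [lra|field; lra]. }
      auto_derive; [repeat split; lra|].
      destruct n as [|n]; [simpl; field; lra|].
      rewrite Nat.pred_succ, S_INR; simpl (_ ^ _); field; lra.
Qed.

Lemma smooth2_flat_affine n k c :
  smooth2 (fun _ _ => True) (fun _ s => flat n (k * s + c)).
Proof.
  assert (oT : open2 (fun _ _ => True)).
  { intros t s _; now apply locally_2d_forall. }
  assert (D : forall n s, is_derive (fun s => flat n (k * s + c)) s
     (k * (flat (S (S n)) (k * s + c) - INR n * flat (S n) (k * s + c)))).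
  { intros m s.
    apply (is_derive_comp (flat m) (fun s => k * s + c)); [apply is_derive_flat|].
    auto_derive; [easy|ring]. }
  intros m.
  (* As for [smooth2_static], the claim must range over all [n]: a derivative of [flat n] involves
     [flat (S n)] and [flat (S (S n))]. *)
  assert (H : forall n, Ck (fun _ _ => True) m (fun _ s => flat n (k * s + c))).
  2: exact (H n).
  clear n; induction m as [|m IH]; intros n.
  - intros t s _; split; [|easy].
    apply (continuity_1d_2d_pt_comp (fun s => flat n (k * s + c)) (fun _ s => s)).
    + apply continuity_pt_filterlim, (ex_derive_continuous (fun s => flat n (k * s + c))).
      eexists; apply D.
    + apply continuity_2d_pt_id2.
  - apply Ck_S; split; [|split; [|split; [|split]]]; intros.
    + apply (continuity_1d_2d_pt_comp (fun s => flat n (k * s + c)) (fun _ s => s)).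
      * apply continuity_pt_filterlim, (ex_derive_continuous (fun s => flat n (k * s + c))).
        eexists; apply D.
      * apply continuity_2d_pt_id2.
    + apply ex_derive_const.
    + eexists; apply D.
    + apply Ck_ext with (fun _ _ => 0); [easy| |apply Ck_const; easy].
      intros; symmetry; exact (Derive_const _ _).
    + apply Ck_ext with (fun _ s =>
        k * (flat (S (S n)) (k * s + c) + (- INR n) * flat (S n) (k * s + c))).
      * easy.
      * intros t s _; symmetry; etransitivity; [apply is_derive_unique, D|ring].
      * repeat first [apply Ck_mult | apply Ck_plus | apply Ck_const | apply IH | easy].
Qed.

(** The arguments are kept in the form [k * s + c] so that both factors are instances of
    [smooth2_flat_affine], with slopes 1 and -1. *)
Definition bump (a b s : R) : R := flat 0 (1 * s + - a) * flat 0 ((-1) * s + b).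

Lemma smooth2_bump a b : smooth2 (fun _ _ => True) (fun _ => bump a b).
Proof.
  apply smooth2_mult; [|apply smooth2_flat_affine..].
  intros t s _; now apply locally_2d_forall.
Qed.

Lemma bump_gt_0 a b s : a < s < b -> 0 < bump a b s.
Proof. intros h; apply Rmult_lt_0_compat; apply flat_gt_0; lra. Qed.

Lemma bump_eq_0 a b s : s <= a \/ b <= s -> bump a b s = 0.
Proof.
  intros [h|h]; unfold bump.
  - rewrite (flat_neg 0 (1 * s + - a)) by lra; ring.
  - rewrite (flat_neg 0 ((-1) * s + b)) by lra; ring.
Qed.

(** * Vector calculus *)

Definition vsmooth2 (U : R -> R -> Prop) (F : R -> R -> vec) : Prop :=
  smooth2 U (fun t s => cx (F t s)) /\
  smooth2 U (fun t s => cy (F t s)) /\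
  smooth2 U (fun t s => cz (F t s)).

Definition is_vderive (F : R -> vec) (s : R) (l : vec) : Prop :=
  is_derive (fun r => cx (F r)) s (cx l) /\
  is_derive (fun r => cy (F r)) s (cy l) /\
  is_derive (fun r => cz (F r)) s (cz l).

Lemma vec_ext (a b : vec) : cx a = cx b -> cy a = cy b -> cz a = cz b -> a = b.
Proof.
  destruct a as [[a1 a2] a3], b as [[b1 b2] b3]; unfold cx, cy, cz; simpl.
  now intros -> -> ->.
Qed.

Ltac vec_ring :=
  unfold det3, dot, vadd, vscale, cross, cx, cy, cz in *; cbn [fst snd] in *; ring.

Lemma is_derive_eq (f : R -> R) (s l l' : R) :
  is_derive f s l -> l = l' -> is_derive f s l'.
Proof. now intros h <-. Qed.

Lemma is_vderive_ext_loc (F G : R -> vec) (s : R) (l : vec) :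
  locally s (fun r => F r = G r) -> is_vderive F s l -> is_vderive G s l.
Proof.
  intros h (h1 & h2 & h3); split; [|split];
    (eapply is_derive_ext_loc; [|eassumption]);
    revert h; apply filter_imp; now intros r ->.
Qed.

Lemma is_vderive_vscale (f : R -> R) (F : R -> vec) (s f' : R) (F' : vec) :
  is_derive f s f' -> is_vderive F s F' ->
  is_vderive (fun r => vscale (f r) (F r)) s (vadd (vscale f' (F s)) (vscale (f s) F')).
Proof.
  intros hf (h1 & h2 & h3).
  pose proof (is_derive_mult _ _ _ _ _ hf h1 Rmult_comm) as m1.
  pose proof (is_derive_mult _ _ _ _ _ hf h2 Rmult_comm) as m2.
  pose proof (is_derive_mult _ _ _ _ _ hf h3 Rmult_comm) as m3.
  split; [|split]; assumption.
Qed.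

Lemma is_vderive_vadd (F G : R -> vec) (s : R) (F' G' : vec) :
  is_vderive F s F' -> is_vderive G s G' ->
  is_vderive (fun r => vadd (F r) (G r)) s (vadd F' G').
Proof.
  intros (f1 & f2 & f3) (g1 & g2 & g3).
  pose proof (is_derive_plus _ _ _ _ _ f1 g1) as m1.
  pose proof (is_derive_plus _ _ _ _ _ f2 g2) as m2.
  pose proof (is_derive_plus _ _ _ _ _ f3 g3) as m3.
  split; [|split]; assumption.
Qed.

Lemma is_derive_dot (F G : R -> vec) (s : R) (F' G' : vec) :
  is_vderive F s F' -> is_vderive G s G' ->
  is_derive (fun r => dot (F r) (G r)) s (dot F' (G s) + dot (F s) G').
Proof.
  intros (f1 & f2 & f3) (g1 & g2 & g3).
  pose proof (is_derive_plus _ _ _ _ _ (is_derive_plus _ _ _ _ _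
    (is_derive_mult _ _ _ _ _ f1 g1 Rmult_comm)
    (is_derive_mult _ _ _ _ _ f2 g2 Rmult_comm))
    (is_derive_mult _ _ _ _ _ f3 g3 Rmult_comm)) as m.
  apply (is_derive_eq _ _ _ _ m).
  unfold plus, mult, dot; simpl; ring.
Qed.

Lemma is_vderive_cross (F G : R -> vec) (s : R) (F' G' : vec) :
  is_vderive F s F' -> is_vderive G s G' ->
  is_vderive (fun r => cross (F r) (G r)) s (vadd (cross F' (G s)) (cross (F s) G')).
Proof.
  intros (f1 & f2 & f3) (g1 & g2 & g3).
  pose proof (is_derive_minus _ _ _ _ _
    (is_derive_mult _ _ _ _ _ f2 g3 Rmult_comm)
    (is_derive_mult _ _ _ _ _ f3 g2 Rmult_comm)) as m1.
  pose proof (is_derive_minus _ _ _ _ _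
    (is_derive_mult _ _ _ _ _ f3 g1 Rmult_comm)
    (is_derive_mult _ _ _ _ _ f1 g3 Rmult_comm)) as m2.
  pose proof (is_derive_minus _ _ _ _ _
    (is_derive_mult _ _ _ _ _ f1 g2 Rmult_comm)
    (is_derive_mult _ _ _ _ _ f2 g1 Rmult_comm)) as m3.
  split; [|split];
    [apply (is_derive_eq _ _ _ _ m1)|apply (is_derive_eq _ _ _ _ m2)
    |apply (is_derive_eq _ _ _ _ m3)];
    unfold minus, plus, opp, mult, vadd, cross, cx, cy, cz; simpl; ring.
Qed.

Section SmoothVectors.

Variable U : R -> R -> Prop.
Hypothesis openU : open2 U.

Lemma smooth2_dot F G :
  vsmooth2 U F -> vsmooth2 U G -> smooth2 U (fun t s => dot (F t s) (G t s)).
Proof.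
  intros (f1 & f2 & f3) (g1 & g2 & g3); unfold dot.
  repeat apply smooth2_plus; try apply smooth2_mult; assumption.
Qed.

Lemma vsmooth2_cross F G :
  vsmooth2 U F -> vsmooth2 U G -> vsmooth2 U (fun t s => cross (F t s) (G t s)).
Proof.
  intros (f1 & f2 & f3) (g1 & g2 & g3).
  pose proof (smooth2_minus U openU _ _ (smooth2_mult U openU _ _ f2 g3)
    (smooth2_mult U openU _ _ f3 g2)) as m1.
  pose proof (smooth2_minus U openU _ _ (smooth2_mult U openU _ _ f3 g1)
    (smooth2_mult U openU _ _ f1 g3)) as m2.
  pose proof (smooth2_minus U openU _ _ (smooth2_mult U openU _ _ f1 g2)
    (smooth2_mult U openU _ _ f2 g1)) as m3.
  split; [|split]; assumption.
Qed.

Lemma vsmooth2_vscale f F :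
  smooth2 U f -> vsmooth2 U F -> vsmooth2 U (fun t s => vscale (f t s) (F t s)).
Proof.
  intros hf (f1 & f2 & f3).
  pose proof (smooth2_mult U openU _ _ hf f1) as m1.
  pose proof (smooth2_mult U openU _ _ hf f2) as m2.
  pose proof (smooth2_mult U openU _ _ hf f3) as m3.
  split; [|split]; assumption.
Qed.

Lemma vsmooth2_vadd F G :
  vsmooth2 U F -> vsmooth2 U G -> vsmooth2 U (fun t s => vadd (F t s) (G t s)).
Proof.
  intros (f1 & f2 & f3) (g1 & g2 & g3).
  pose proof (smooth2_plus U openU _ _ f1 g1) as m1.
  pose proof (smooth2_plus U openU _ _ f2 g2) as m2.
  pose proof (smooth2_plus U openU _ _ f3 g3) as m3.
  split; [|split]; assumption.
Qed.

Lemma vsmooth2_const a : vsmooth2 U (fun _ _ => a).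
Proof. split; [|split]; now apply smooth2_const. Qed.

Lemma vsmooth2_curve_deriv G k :
  vsmooth2 U G -> vsmooth2 U (fun t s => curve_deriv k (G t) s).
Proof.
  intros (g1 & g2 & g3).
  pose proof (smooth2_Derive_n U _ k g1) as m1.
  pose proof (smooth2_Derive_n U _ k g2) as m2.
  pose proof (smooth2_Derive_n U _ k g3) as m3.
  split; [|split]; assumption.
Qed.

Lemma vsmooth2_is_vderive_s G k t s : vsmooth2 U G -> U t s ->
  is_vderive (curve_deriv k (G t)) s (curve_deriv (S k) (G t) s).
Proof.
  intros hG h; destruct (vsmooth2_curve_deriv G k hG) as (g1 & g2 & g3).
  split; [|split]; apply Derive_correct.
  - exact (smooth2_ex_derive_s U _ t s g1 h).
  - exact (smooth2_ex_derive_s U _ t s g2 h).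
  - exact (smooth2_ex_derive_s U _ t s g3 h).
Qed.

Definition velocity (G : R -> curve) (t s : R) : vec :=
  (dt (fun t s => cx (G t s)) t s,
   dt (fun t s => cy (G t s)) t s,
   dt (fun t s => cz (G t s)) t s).

Lemma vsmooth2_velocity G : vsmooth2 U G -> vsmooth2 U (velocity G).
Proof.
  intros (g1 & g2 & g3).
  pose proof (smooth2_dt U _ g1); pose proof (smooth2_dt U _ g2);
    pose proof (smooth2_dt U _ g3).
  split; [|split]; assumption.
Qed.

(** The exchange of t- and s-derivatives for curves: moving a curve with velocity V moves its k-th
    derivative with velocity V^(k). *)
Lemma vsmooth2_is_vderive_t G k t s : vsmooth2 U G -> U t s ->
  is_vderive (fun r => curve_deriv k (G r) s) t (curve_deriv k (velocity G t) s).
Proof.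
  intros hG h.
  destruct (vsmooth2_curve_deriv G k hG) as (g1 & g2 & g3), hG as (h1 & h2 & h3).
  split; [|split].
  - apply (is_derive_eq _ _ _ _
      (Derive_correct _ _ (smooth2_ex_derive_t U _ t s g1 h))).
    exact (smooth2_dt_Derive_n U openU _ k t s h1 h).
  - apply (is_derive_eq _ _ _ _
      (Derive_correct _ _ (smooth2_ex_derive_t U _ t s g2 h))).
    exact (smooth2_dt_Derive_n U openU _ k t s h2 h).
  - apply (is_derive_eq _ _ _ _
      (Derive_correct _ _ (smooth2_ex_derive_t U _ t s g3 h))).
    exact (smooth2_dt_Derive_n U openU _ k t s h3 h).
Qed.

End SmoothVectors.

Lemma vsmooth2_sub (U V : R -> R -> Prop) F :
  (forall t s, V t s -> U t s) -> vsmooth2 U F -> vsmooth2 V F.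
Proof.
  intros h (h1 & h2 & h3); split; [|split]; apply (smooth2_sub U V); auto.
Qed.

Lemma vsmooth2_at_time (U : R -> R -> Prop) (I : R -> Prop) F t0 :
  open2 (fun _ s => I s) -> (forall s, I s -> U t0 s) -> vsmooth2 U F ->
  vsmooth2 (fun _ s => I s) (fun _ => F t0).
Proof.
  intros oI h (h1 & h2 & h3); split; [|split].
  - exact (smooth2_at_time U I _ t0 oI h h1).
  - exact (smooth2_at_time U I _ t0 oI h h2).
  - exact (smooth2_at_time U I _ t0 oI h h3).
Qed.

(** * The integrand as a function of c', c'' and c''' *)

Definition speed2 (c : curve) (s : R) : R :=
  dot (curve_deriv 1 c s) (curve_deriv 1 c s).
Definition wedge (c : curve) (s : R) : vec :=
  cross (curve_deriv 1 c s) (curve_deriv 2 c s).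
Definition wedge2 (c : curve) (s : R) : R := dot (wedge c s) (wedge c s).
Definition volume (c : curve) (s : R) : R := dot (wedge c s) (curve_deriv 3 c s).

Definition integrand (mu : R) (c : curve) (s : R) : R :=
  (curvature c s ^ 2 * (1 + mod_torsion c s ^ 2) ^ 2 - mu) * speed c s.

Definition lagrangian (mu p q w : R) : R :=
  (q / p ^ 3 * (1 + w ^ 2 * p ^ 3 / q ^ 3) ^ 2 - mu) * sqrt p.

Lemma dot_self_ge_0 a : 0 <= dot a a.
Proof. unfold dot; nra. Qed.

Lemma dot_self_eq_0 a : dot a a = 0 -> a = vzero.
Proof.
  unfold dot; intros h; apply vec_ext; unfold vzero, cx, cy, cz in *; simpl; nra.
Qed.

Lemma dot_self_gt_0 a : a <> vzero -> 0 < dot a a.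
Proof.
  intros h; destruct (dot_self_ge_0 a) as [k|k]; [easy|].
  now elim h; apply dot_self_eq_0.
Qed.

Lemma vnorm_gt_0 a : 0 < dot a a -> 0 < vnorm a.
Proof. apply sqrt_lt_R0. Qed.

(** Curvature is sqrt q / (sqrt p)^3 and modified torsion is w (sqrt p)^3 / (sqrt q)^3. Both enter
    through their squares, so the only root left is the speed sqrt p. Writing p and q as squares of
    [a] and [b] makes the identity rational. *)
Lemma integrand_lagrangian mu c s : 0 < speed2 c s -> 0 < wedge2 c s ->
  integrand mu c s = lagrangian mu (speed2 c s) (wedge2 c s) (volume c s).
Proof.
  intros hp hq.
  unfold integrand, mod_torsion, torsion, curvature, speed, vnorm, lagrangian, det3.
  fold (wedge c s); fold (wedge2 c s); fold (speed2 c s); fold (volume c s).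
  assert (ha := sqrt_lt_R0 _ hp); assert (hb := sqrt_lt_R0 _ hq).
  assert (ea := sqrt_sqrt _ (Rlt_le _ _ hp)); assert (eb := sqrt_sqrt _ (Rlt_le _ _ hq)).
  set (a := sqrt (speed2 c s)) in *; set (b := sqrt (wedge2 c s)) in *.
  rewrite <- ea, <- eb; field; lra.
Qed.

Section SmoothFrenet.

Variable U : R -> R -> Prop.
Hypothesis openU : open2 U.
Variable G : R -> curve.
Hypothesis smoothG : vsmooth2 U G.

Lemma smooth2_speed2 : smooth2 U (fun t s => speed2 (G t) s).
Proof. now apply smooth2_dot; [|apply vsmooth2_curve_deriv..]. Qed.

Lemma vsmooth2_wedge : vsmooth2 U (fun t s => wedge (G t) s).
Proof. now apply vsmooth2_cross; [|apply vsmooth2_curve_deriv..]. Qed.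

Lemma smooth2_wedge2 : smooth2 U (fun t s => wedge2 (G t) s).
Proof. now apply smooth2_dot; [|apply vsmooth2_wedge..]. Qed.

Lemma smooth2_volume : smooth2 U (fun t s => volume (G t) s).
Proof.
  now apply smooth2_dot; [|apply vsmooth2_wedge|apply vsmooth2_curve_deriv].
Qed.

Hypothesis speed2_pos : forall t s, U t s -> 0 < speed2 (G t) s.
Hypothesis wedge2_pos : forall t s, U t s -> 0 < wedge2 (G t) s.

Lemma smooth2_speed : smooth2 U (fun t s => speed (G t) s).
Proof. apply (smooth2_sqrt U openU _ speed2_pos), smooth2_speed2. Qed.

Lemma smooth2_wedge_norm : smooth2 U (fun t s => vnorm (wedge (G t) s)).
Proof. apply (smooth2_sqrt U openU _ wedge2_pos), smooth2_wedge2. Qed.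

Lemma speed_neq_0 t s : U t s -> speed (G t) s <> 0.
Proof. intros h; apply Rgt_not_eq, vnorm_gt_0, speed2_pos; easy. Qed.

Lemma wedge_norm_neq_0 t s : U t s -> vnorm (wedge (G t) s) <> 0.
Proof. intros h; apply Rgt_not_eq, vnorm_gt_0, wedge2_pos; easy. Qed.

Lemma curvature_neq_0 t s : U t s -> curvature (G t) s <> 0.
Proof.
  intros h; apply Rmult_integral_contrapositive_currified.
  - exact (wedge_norm_neq_0 t s h).
  - apply Rinv_neq_0_compat, pow_nonzero, speed_neq_0, h.
Qed.

Lemma smooth2_curvature : smooth2 U (fun t s => curvature (G t) s).
Proof.
  apply smooth2_div; [easy| |apply smooth2_wedge_norm|].
  - intros t s h; apply pow_nonzero, speed_neq_0, h.
  - apply smooth2_pow; [easy|apply smooth2_speed].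
Qed.

Lemma smooth2_mod_torsion : smooth2 U (fun t s => mod_torsion (G t) s).
Proof.
  apply smooth2_div; [easy| | |apply smooth2_curvature].
  - intros t s h; apply curvature_neq_0, h.
  - apply smooth2_div; [easy| |apply smooth2_volume|].
    + intros t s h; apply pow_nonzero, (wedge_norm_neq_0 t s h).
    + apply smooth2_pow; [easy|apply smooth2_wedge_norm].
Qed.

Lemma vsmooth2_tangent : vsmooth2 U (fun t s => tangent (G t) s).
Proof.
  apply vsmooth2_vscale; [easy| |now apply vsmooth2_curve_deriv].
  apply smooth2_inv; [easy| |apply smooth2_speed].
  intros t s h; apply speed_neq_0, h.
Qed.

Lemma vsmooth2_binormal : vsmooth2 U (fun t s => binormal (G t) s).
Proof.
  apply vsmooth2_vscale; [easy| |apply vsmooth2_wedge].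
  apply smooth2_inv; [easy| |apply smooth2_wedge_norm].
  intros t s h; apply wedge_norm_neq_0, h.
Qed.

Lemma vsmooth2_normal : vsmooth2 U (fun t s => normal (G t) s).
Proof.
  now apply vsmooth2_cross; [|apply vsmooth2_binormal|apply vsmooth2_tangent].
Qed.

Lemma smooth2_integrand mu : smooth2 U (fun t s => integrand mu (G t) s).
Proof.
  repeat first [easy | apply smooth2_speed | apply smooth2_curvature
    | apply smooth2_mod_torsion | apply smooth2_mult | apply smooth2_minus
    | apply smooth2_plus | apply smooth2_pow | apply smooth2_const ].
Qed.

End SmoothFrenet.

(** * Frenet equations *)

Lemma dot_comm a b : dot a b = dot b a.
Proof. vec_ring. Qed.

Lemma dot_cross_cross a b :
  dot (cross a b) (cross a b) = dot a a * dot b b - dot a b ^ 2.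
Proof. vec_ring. Qed.

(* Expands [b x (x x b)] in two ways, with [b = a x n]. *)
Lemma orthonormal_expansion a n x :
  dot a a = 1 -> dot n n = 1 -> dot a n = 0 ->
  x = vadd (vadd (vscale (dot x a) a) (vscale (dot x n) n))
           (vscale (dot x (cross a n)) (cross a n)).
Proof.
  intros ha hn han.
  assert (E : forall xi ai ni bi : R,
    xi * (dot a a * dot n n - dot a n ^ 2) =
    dot x n * (ni * dot a a - ai * dot a n) - dot x a * (ni * dot a n - ai * dot n n)
      + dot x (cross a n) * bi ->
    xi = dot x a * ai + dot x n * ni + dot x (cross a n) * bi).
  { intros xi ai ni bi h; rewrite ha, hn, han in h; lra. }
  apply vec_ext.
  - apply (E (cx x) (cx a) (cx n) (cx (cross a n))); vec_ring.
  - apply (E (cy x) (cy a) (cy n) (cy (cross a n))); vec_ring.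
  - apply (E (cz x) (cz a) (cz n) (cz (cross a n))); vec_ring.
Qed.

Record frenet_at (c : curve) (s : R) : Prop := {
  fr_curvature_pos : 0 < curvature c s;
  fr_speed2 : speed2 c s = 1;
  fr_wedge : wedge c s = vscale (curvature c s) (binormal c s);
  fr_wedge2 : wedge2 c s = curvature c s ^ 2;
  fr_volume : volume c s = curvature c s ^ 3 * mod_torsion c s;
  fr_d1 : curve_deriv 1 c s = tangent c s;
  fr_d2 : curve_deriv 2 c s = vscale (curvature c s) (normal c s);
  fr_d3 : curve_deriv 3 c s =
    vadd (vadd (vscale (- curvature c s ^ 2) (tangent c s))
               (vscale (Derive (curvature c) s) (normal c s)))
         (vscale (curvature c s ^ 2 * mod_torsion c s) (binormal c s));
  fr_TN : cross (tangent c s) (normal c s) = binormal c s;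
  fr_NB : cross (normal c s) (binormal c s) = tangent c s;
  fr_BT : cross (binormal c s) (tangent c s) = normal c s;
  fr_normal : is_vderive (normal c) s
    (vadd (vscale (- curvature c s) (tangent c s))
          (vscale (curvature c s * mod_torsion c s) (binormal c s)));
  fr_binormal : is_vderive (binormal c) s
    (vscale (- (curvature c s * mod_torsion c s)) (normal c s))
}.

Section UnitSpeed.

Variable J : R -> Prop.
Hypothesis openJ : open2 (fun _ s => J s).
Variable c : curve.
Hypothesis smooth_c : vsmooth2 (fun _ s => J s) (fun _ => c).
Hypothesis unit_speed : forall s, J s -> speed c s = 1.
Hypothesis wedge2_pos : forall s, J s -> 0 < wedge2 c s.

Lemma unit_speed2 s : J s -> speed2 c s = 1.
Proof.
  intros h; pose proof (unit_speed s h) as e; unfold speed, vnorm in e.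
  fold (speed2 c s) in e.
  rewrite <- (sqrt_sqrt (speed2 c s)) by apply dot_self_ge_0.
  rewrite e; ring.
Qed.

Lemma unit_speed_deriv k s : J s -> is_vderive (curve_deriv k c) s (curve_deriv (S k) c s).
Proof. exact (vsmooth2_is_vderive_s _ (fun _ => c) k 0 s smooth_c). Qed.

(** The device for differentiating an identity that holds on the open set [J]; the relations among
    c', c'', c''' below all come from it. *)
Lemma derive_locally_eq (f g : R -> R) s l m : J s ->
  (forall r, J r -> f r = g r) -> is_derive f s l -> is_derive g s m -> l = m.
Proof.
  intros h e hf hg; rewrite <- (is_derive_unique _ _ _ hf), <- (is_derive_unique _ _ _ hg).
  apply Derive_ext_loc; generalize (open2_locally_s _ 0 s openJ h).
  apply filter_imp; exact e.
Qed.

Lemma unit_speed_d1_d2 s : J s -> dot (curve_deriv 1 c s) (curve_deriv 2 c s) = 0.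
Proof.
  intros h; pose proof (unit_speed_deriv 1 s h) as d.
  pose proof (derive_locally_eq _ _ s _ _ h unit_speed2
    (is_derive_dot _ _ _ _ _ d d) (is_derive_const 1 s)) as e.
  rewrite (dot_comm (curve_deriv 2 c s)) in e; unfold zero in e; simpl in e; lra.
Qed.

(** Differentiating c'.c'' = 0 gives c'.c''' = -|c''|^2, and |c''|^2 = |c' x c''|^2 because c' is a
    unit vector orthogonal to c''. *)
Lemma unit_speed_d1_d3 s : J s ->
  dot (curve_deriv 1 c s) (curve_deriv 3 c s) = - wedge2 c s.
Proof.
  intros h; pose proof (unit_speed_deriv 1 s h) as d1.
  pose proof (unit_speed_deriv 2 s h) as d2.
  pose proof (derive_locally_eq _ _ s _ _ h unit_speed_d1_d2
    (is_derive_dot _ _ _ _ _ d1 d2) (is_derive_const 0 s)) as e.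
  unfold wedge2, wedge; rewrite dot_cross_cross, (unit_speed_d1_d2 s h).
  pose proof (unit_speed2 s h) as u; unfold speed2 in u; rewrite u.
  unfold zero in e; simpl in e; lra.
Qed.

Lemma unit_speed_wedge2 s : J s ->
  wedge2 c s = dot (curve_deriv 2 c s) (curve_deriv 2 c s).
Proof.
  intros h; unfold wedge2, wedge; rewrite dot_cross_cross, (unit_speed_d1_d2 s h).
  pose proof (unit_speed2 s h) as u; unfold speed2 in u; rewrite u; ring.
Qed.

Lemma unit_speed_curvature s : J s -> curvature c s = vnorm (wedge c s).
Proof.
  intros h; unfold curvature, wedge; rewrite (unit_speed s h); field.
Qed.

Lemma unit_speed_curvature_pos s : J s -> 0 < curvature c s.
Proof. intros h; rewrite unit_speed_curvature by easy; now apply vnorm_gt_0, wedge2_pos. Qed.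

Lemma unit_speed_curvature_sq s : J s -> curvature c s ^ 2 = wedge2 c s.
Proof.
  intros h; rewrite unit_speed_curvature by easy.
  simpl; rewrite Rmult_1_r; apply sqrt_sqrt, dot_self_ge_0.
Qed.

Lemma unit_speed_is_derive_curvature s : J s ->
  is_derive (curvature c) s (Derive (curvature c) s).
Proof.
  intros h; apply Derive_correct.
  refine (smooth2_ex_derive_s (fun _ s => J s) (fun _ => curvature c) 0 s _ h).
  apply (smooth2_curvature _ openJ _ smooth_c); [|easy].
  intros t r k; rewrite unit_speed2 by easy; lra.
Qed.

(** Half the derivative of the identity |c''|^2 = curvature^2. *)
Lemma unit_speed_d2_d3 s : J s ->
  dot (curve_deriv 2 c s) (curve_deriv 3 c s) = curvature c s * Derive (curvature c) s.
Proof.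
  intros h; pose proof (unit_speed_deriv 2 s h) as d.
  assert (e : forall r, J r -> dot (curve_deriv 2 c r) (curve_deriv 2 c r) = curvature c r ^ 2).
  { intros r k; rewrite unit_speed_curvature_sq, unit_speed_wedge2; easy. }
  pose proof (unit_speed_is_derive_curvature s h) as dk.
  pose proof (derive_locally_eq _ _ s _ _ h e
    (is_derive_dot _ _ _ _ _ d d) (is_derive_pow _ 2 _ _ dk)) as E.
  rewrite (dot_comm (curve_deriv 3 c s)) in E; simpl in E; lra.
Qed.

Lemma unit_speed_tangent s : J s -> tangent c s = curve_deriv 1 c s.
Proof.
  intros h; unfold tangent; rewrite (unit_speed s h), Rinv_1.
  apply vec_ext; vec_ring.
Qed.

Lemma unit_speed_binormal s : J s ->
  binormal c s = vscale (/ curvature c s) (wedge c s).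
Proof. intros h; rewrite unit_speed_curvature; easy. Qed.

Lemma unit_speed_normal s : J s ->
  normal c s = vscale (/ curvature c s) (curve_deriv 2 c s).
Proof.
  intros h; unfold normal; rewrite unit_speed_tangent, unit_speed_binormal by easy.
  pose proof (unit_speed2 s h) as u; pose proof (unit_speed_d1_d2 s h) as v.
  unfold speed2 in u; unfold wedge.
  set (a := curve_deriv 1 c s) in *; set (b := curve_deriv 2 c s) in *.
  set (i := / curvature c s).
  (* Triple product expansion (a x b) x a = (a.a) b - (a.b) a, with a.a = 1 and a.b = 0. *)
  transitivity (vscale i (vadd (vscale (dot a a) b) (vscale (- dot a b) a))).
  - apply vec_ext; vec_ring.
  - rewrite u, v; apply vec_ext; vec_ring.
Qed.

Lemma unit_speed_frenet s : J s -> frenet_at c s.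
Proof.
  intros h.
  pose proof (unit_speed2 s h) as hp; pose proof (unit_speed_curvature_pos s h) as hk.
  pose proof (unit_speed_curvature_sq s h) as hq; pose proof (unit_speed_d1_d2 s h) as h12.
  pose proof (unit_speed_d1_d3 s h) as h13; pose proof (unit_speed_d2_d3 s h) as h23.
  pose proof (unit_speed_wedge2 s h) as h22.
  pose proof (unit_speed_tangent s h) as hT; pose proof (unit_speed_normal s h) as hN.
  pose proof (unit_speed_binormal s h) as hB.
  assert (hTN : cross (tangent c s) (normal c s) = binormal c s).
  { rewrite hT, hN, hB; unfold wedge; apply vec_ext; vec_ring. }
  assert (d2 : curve_deriv 2 c s = vscale (curvature c s) (normal c s)).
  { rewrite hN; unfold vscale; apply vec_ext; unfold cx, cy, cz; cbn [fst snd]; field; lra. }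
  assert (hw : wedge c s = vscale (curvature c s) (binormal c s)).
  { rewrite hB; unfold vscale; apply vec_ext; unfold cx, cy, cz; cbn [fst snd]; field; lra. }
  assert (hvol : volume c s = curvature c s ^ 3 * mod_torsion c s).
  { unfold mod_torsion, torsion, det3.
    fold (wedge c s); fold (volume c s).
    rewrite <- unit_speed_curvature by easy; field; lra. }
  set (T := tangent c s) in *; set (N := normal c s) in *; set (B := binormal c s) in *.
  set (k := curvature c s) in *; set (l := mod_torsion c s) in *.
  pose proof hp as hTT; unfold speed2 in hTT; rewrite <- hT in hTT, h12, h13.
  assert (hTN0 : dot T N = 0).
  { rewrite d2 in h12; replace (dot T (vscale k N)) with (k * dot T N) in h12 by vec_ring; nra. }
  assert (hNN : dot N N = 1).
  { rewrite h22, d2 in hq.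
    replace (dot (vscale k N) (vscale k N)) with (k ^ 2 * dot N N) in hq by vec_ring.
    assert (0 < k ^ 2) by (apply pow_lt; easy).
    apply Rmult_eq_reg_l with (k ^ 2); lra. }
  assert (hNB : cross N B = T).
  { rewrite <- hTN.
    transitivity (vadd (vscale (dot N N) T) (vscale (- dot T N) N));
      [|rewrite hNN, hTN0]; apply vec_ext; vec_ring. }
  assert (hBT : cross B T = N) by reflexivity.
  (* The coordinates of c''' in the frame: along T it is c'.c''' = -k^2; along N and B the
     coordinate times k is c''.c''' = k k' and the volume k^3 l, respectively. *)
  assert (d3 : curve_deriv 3 c s =
    vadd (vadd (vscale (- k ^ 2) T) (vscale (Derive (curvature c) s) N))
         (vscale (k ^ 2 * l) B)).
  { rewrite (orthonormal_expansion T N (curve_deriv 3 c s)) by easy.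
    rewrite hTN, (dot_comm _ T), h13, <- hq.
    f_equal; [f_equal|]; f_equal.
    - apply Rmult_eq_reg_l with k; [|lra].
      rewrite <- h23, d2; vec_ring.
    - apply Rmult_eq_reg_l with k; [|lra].
      transitivity (volume c s); [unfold volume; rewrite hw; vec_ring|].
      rewrite hvol; ring. }
  (* Near s, N = c''/k. In (1/k)' c'' + c'''/k the two contributions along N cancel. *)
  assert (dN : is_vderive (normal c) s (vadd (vscale (- k) T) (vscale (k * l) B))).
  { apply is_vderive_ext_loc with (fun r => vscale (/ curvature c r) (curve_deriv 2 c r)).
    - generalize (open2_locally_s _ 0 s openJ h); apply filter_imp.
      intros r hr; symmetry; now apply unit_speed_normal.
    - pose proof (is_vderive_vscale _ _ s _ _
        (is_derive_inv _ _ _ (unit_speed_is_derive_curvature s h) (Rgt_not_eq _ _ hk))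
        (unit_speed_deriv 2 s h)) as D.
      cbv beta in D; fold k in D; rewrite d2, d3 in D.
      match type of D with is_vderive _ _ ?u =>
        replace (vadd (vscale (- k) T) (vscale (k * l) B)) with u; [exact D|] end.
      apply vec_ext; unfold vadd, vscale, cx, cy, cz; cbn [fst snd]; field; lra. }
  split; auto.
  (* From B = c' x N near s: c'' x N vanishes since c'' = k N, and T x N' leaves k l (T x B) = -k l
     N. *)
  change (is_vderive (binormal c) s (vscale (- (k * l)) N)).
  apply is_vderive_ext_loc with (fun r => cross (curve_deriv 1 c r) (normal c r)).
  - generalize (open2_locally_s _ 0 s openJ h); apply filter_imp.
    intros r hr; rewrite unit_speed_normal, unit_speed_binormal by easy.
    unfold wedge; apply vec_ext; vec_ring.
  - pose proof (is_vderive_cross _ _ s _ _ (unit_speed_deriv 1 s h) dN) as D.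
    cbv beta in D; fold N in D; rewrite d2, <- hT in D.
    match type of D with is_vderive _ _ ?u =>
      replace (vscale (- (k * l)) N) with u; [exact D|] end.
    transitivity (vscale (- (k * l)) (cross B T)); [|now rewrite hBT].
    clearbody T N B; apply vec_ext; vec_ring.
Qed.

End UnitSpeed.

(** * The variation of the integrand *)

(** The chain rule, with the partial derivatives evaluated at p = 1, q = k^2, w = k^3 l, where w^2
    p^3 / q^3 is l^2. The coefficient -5/2 is -3 from p^(-3) plus 1/2 from sqrt p. *)
Lemma is_derive_lagrangian mu (p q w : R -> R) t p' q' w' k l :
  is_derive p t p' -> is_derive q t q' -> is_derive w t w' ->
  p t = 1 -> q t = k ^ 2 -> w t = k ^ 3 * l -> 0 < k ->
  is_derive (fun r => lagrangian mu (p r) (q r) (w r)) t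
    ((- 5 / 2 * k ^ 2 * (1 + l ^ 2) ^ 2 + 6 * k ^ 2 * (1 + l ^ 2) * l ^ 2 - mu / 2) * p'
     + ((1 + l ^ 2) ^ 2 - 6 * (1 + l ^ 2) * l ^ 2) * q'
     + 4 * (1 + l ^ 2) * l / k * w').
Proof.
  intros hp hq hw ep eq ew hk.
  assert (hk2 : 0 < k ^ 2) by now apply pow_lt.
  unfold lagrangian; auto_derive.
  - rewrite ep, eq; repeat split; try (eexists; eassumption);
      rewrite ?Rmult_1_r; repeat apply Rmult_integral_contrapositive_currified; lra.
  - rewrite (is_derive_unique (fun x : R => p x) _ _ hp), (is_derive_unique (fun x : R => q x) _ _ hq),
      (is_derive_unique (fun x : R => w x) _ _ hw), ep, eq, ew, sqrt_1; simpl; field; lra.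
Qed.

(** For the density f(k, tau) = k^2 (1 + tau^2/k^2)^2 this is the partial derivative in tau divided
    by 2k, at tau = k l. It is also the expression differentiated in [force3]. *)
Definition twist (l : R) : R := (1 + l ^ 2) * (2 * l).
(** The partial derivative in k of the same density f(k, tau), with tau held fixed and then set to k
    l. *)
Definition bend (k l : R) : R := 2 * k * (1 + l ^ 2) ^ 2 - 4 * k * (1 + l ^ 2) * l ^ 2.
Definition twist_diff (l l' : R) : R := 2 * l * l' * (2 * l) + (1 + l ^ 2) * (2 * l').
Definition bend_diff (k k' l l' : R) : R :=
  2 * k' * (1 + l ^ 2) ^ 2 + 2 * k * (2 * (1 + l ^ 2) * (2 * l * l'))
  - 4 * (k' * (1 + l ^ 2) * l ^ 2 + k * (2 * l * l') * l ^ 2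
         + k * (1 + l ^ 2) * (2 * l * l')).

Lemma is_derive_twist (l : R -> R) s l' :
  is_derive l s l' -> is_derive (fun r => twist (l r)) s (twist_diff (l s) l').
Proof.
  intros h; unfold twist, twist_diff; auto_derive.
  - repeat split; eexists; eassumption.
  - rewrite (is_derive_unique (fun x : R => l x) _ _ h); simpl; ring.
Qed.

Lemma is_derive_bend (k l : R -> R) s k' l' : is_derive k s k' -> is_derive l s l' ->
  is_derive (fun r => bend (k r) (l r)) s (bend_diff (k s) k' (l s) l').
Proof.
  intros hk hl; unfold bend, bend_diff; auto_derive.
  - repeat split; eexists; eassumption.
  - rewrite (is_derive_unique (fun x : R => k x) _ _ hk),
      (is_derive_unique (fun x : R => l x) _ _ hl); simpl; ring.
Qed.

(* Only valid at unit speed. [d1], [d2], [d3] are the derivatives of the curve, [V1],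
   [V2], [V3] those of the variation field. *)
Definition lagrangian_diff (mu k l : R) (d1 d2 d3 V1 V2 V3 : vec) : R :=
  (- 5 / 2 * k ^ 2 * (1 + l ^ 2) ^ 2 + 6 * k ^ 2 * (1 + l ^ 2) * l ^ 2 - mu / 2)
    * (2 * dot d1 V1)
  + ((1 + l ^ 2) ^ 2 - 6 * (1 + l ^ 2) * l ^ 2)
    * (2 * dot (cross d1 d2) (vadd (cross V1 d2) (cross d1 V2)))
  + 4 * (1 + l ^ 2) * l / k
    * (dot (vadd (cross V1 d2) (cross d1 V2)) d3 + dot (cross d1 d2) V3).

(* The Euler-Lagrange computation in the Frenet frame; [y'] and [z''] stand for
   the two derivatives left unevaluated in [force3]. *)
Lemma lagrangian_diff_frenet mu k k' l l' y' z'' (T N B V1 V2 V3 : vec) :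
  0 < k -> cross T N = B -> cross N B = T -> cross B T = N ->
  let m := -2 * (k' / k * twist l + twist_diff l l') in
  lagrangian_diff mu k l T (vscale k N)
    (vadd (vadd (vscale (- k ^ 2) T) (vscale k' N)) (vscale (k ^ 2 * l) B)) V1 V2 V3 =
  (dot (vadd
          (vadd (vscale (bend_diff k k' l l') N)
                (vscale (bend k l) (vadd (vscale (- k) T) (vscale (k * l) B))))
          (vadd (vscale (-2 * (y' + z'')) B)
                (vscale m (vscale (- (k * l)) N)))) V1
   + dot (vadd (vscale (bend k l) N) (vscale m B)) V2)
  + (dot (vadd (vscale (2 * twist_diff l l') B)
               (vscale (2 * twist l) (vscale (- (k * l)) N))) V2
     + dot (vscale (2 * twist l) B) V3)
  - 2 * dot (vadd (vadd (vscale (/ 2 * (k ^ 2 * (1 + l ^ 2) ^ 2 + mu)) T)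
        (vscale (k' * (1 + l ^ 2) ^ 2 + 2 * k * (1 + l ^ 2) * l * l') N))
        (vscale (- (k ^ 2 * (1 + l ^ 2) ^ 2 * l + y' + z'')) B)) V1.
Proof.
  intros hk hTN hNB hBT m.
  assert (lin : forall a b c V, dot (vadd (vadd (vscale a T) (vscale b N)) (vscale c B)) V
                = a * dot T V + b * dot N V + c * dot B V) by (intros; clear; vec_ring).
  assert (e0 : forall x y : vec, vadd x y = vadd (vadd (vscale 0 T) x) y).
  { intros x y; apply vec_ext; clear; vec_ring. }
  unfold lagrangian_diff; set (d2 := vscale k N).
  set (d3 := vadd (vadd (vscale (- k ^ 2) T) (vscale k' N)) (vscale (k ^ 2 * l) B)).
  (* In [e1], [e2] and [e3] a polynomial identity first regroups the triple products so that only
     cross products of frame vectors meet [V1], [V2], [V3]; the frame relations then evaluate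
     these. *)
  assert (e1 : dot (cross T d2) (vadd (cross V1 d2) (cross T V2))
               = k ^ 2 * dot T V1 + k * dot N V2).
  { transitivity (k ^ 2 * dot (cross N (cross T N)) V1 + k * dot (cross (cross T N) T) V2).
    - unfold d2; clear; vec_ring.
    - now rewrite hTN, hNB, hBT. }
  assert (e2 : dot (vadd (cross V1 d2) (cross T V2)) d3
               = k ^ 3 * dot B V1 + k ^ 3 * l * dot T V1 - k' * dot B V2
                 + k ^ 2 * l * dot N V2).
  { transitivity (k ^ 3 * dot (cross T N) V1 + k ^ 3 * l * dot (cross N B) V1
                  - k' * dot (cross T N) V2 + k ^ 2 * l * dot (cross B T) V2).
    - unfold d2, d3; clear; vec_ring.
    - now rewrite hTN, hNB, hBT. }
  assert (e3 : dot (cross T d2) V3 = k * dot B V3).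
  { rewrite <- hTN; unfold d2; clear; vec_ring. }
  rewrite e1, e2, e3, lin.
  replace (dot (vscale (2 * twist l) B) V3) with (2 * twist l * dot B V3) by (clear; vec_ring).
  replace (dot (vadd (vscale (2 * twist_diff l l') B)
               (vscale (2 * twist l) (vscale (- (k * l)) N))) V2)
    with (2 * twist_diff l l' * dot B V2 - 2 * twist l * (k * l) * dot N V2)
    by (clear; vec_ring).
  replace (dot (vadd (vscale (bend k l) N) (vscale m B)) V2)
    with (bend k l * dot N V2 + m * dot B V2) by (clear; vec_ring).
  match goal with |- context [dot ?v V1 + (bend k l * _ + _)] =>
    replace (dot v V1) with
      (bend_diff k k' l l' * dot N V1 + bend k l * (- k * dot T V1 + k * l * dot B V1)
       + -2 * (y' + z'') * dot B V1 - m * (k * l) * dot N V1) by (clear; vec_ring) end.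
  (* Both sides are now linear in the products of T, N, B with [V1], of N, B with [V2] and of B with
     [V3], with coefficients rational in k. The terms in [y'] and [z''] cancel between the
     derivative of the first momentum and the force. *)
  unfold m, bend, bend_diff, twist, twist_diff; field; lra.
Qed.

(* [potential] collects the boundary terms of the integrations by parts: the variation
   of the integrand is [potential' + 2 b'.V] with [b] the force vector, and [potential]
   vanishes at both ends for a proper variation. *)
Definition momentum1 (c : curve) (s : R) : vec :=
  vadd (vscale (bend (curvature c s) (mod_torsion c s)) (normal c s))
       (vscale (-2 * (Derive (curvature c) s / curvature c s * twist (mod_torsion c s)
                      + Derive (fun r => twist (mod_torsion c r)) s)) (binormal c s)).

(** These are Ostrogradsky's momenta of the integrand F at unit speed: [momentum2] is the gradient
    of F in c''', [momentum1] the gradient in c'' minus the derivative of [momentum2]. The next one,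
    the gradient in c' minus the derivative of [momentum1], is -2 times the force vector. *)
Definition momentum2 (c : curve) (s : R) : vec :=
  vscale (2 * twist (mod_torsion c s)) (binormal c s).

Definition potential (mu : R) (c : curve) (V : R -> vec) (s : R) : R :=
  dot (momentum1 c s) (curve_deriv 1 V s) + dot (momentum2 c s) (curve_deriv 2 V s)
  - 2 * dot (force_vector mu c s) (V s).

Section Potential.

Variable I : R -> Prop.
Let U (_ s : R) : Prop := I s.
Hypothesis openU : open2 U.
Variable c : curve.
Hypothesis smooth_c : vsmooth2 U (fun _ => c).
Hypothesis speed2_pos : forall s, I s -> 0 < speed2 c s.
Hypothesis wedge2_pos : forall s, I s -> 0 < wedge2 c s.

Let pos1 (t s : R) : U t s -> 0 < speed2 c s := speed2_pos s.
Let pos2 (t s : R) : U t s -> 0 < wedge2 c s := wedge2_pos s.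

Let smooth_k : smooth2 U (fun _ s => curvature c s) :=
  smooth2_curvature U openU _ smooth_c pos1 pos2.
Let smooth_l : smooth2 U (fun _ s => mod_torsion c s) :=
  smooth2_mod_torsion U openU _ smooth_c pos1 pos2.
Let smooth_k' : smooth2 U (fun _ s => Derive (curvature c) s) := smooth2_ds U _ smooth_k.
Let smooth_l' : smooth2 U (fun _ s => Derive (mod_torsion c) s) := smooth2_ds U _ smooth_l.
Let k_neq_0 (t s : R) : U t s -> curvature c s <> 0 :=
  curvature_neq_0 U (fun _ => c) pos1 pos2 t s.

Ltac smooth :=
  repeat first
    [ assumption | apply smooth2_const | apply smooth2_plus | apply smooth2_minus
    | apply smooth2_opp | apply smooth2_div | apply smooth2_mult | apply smooth2_pow ].

Lemma smooth_twist : smooth2 U (fun _ s => twist (mod_torsion c s)).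
Proof. unfold twist; smooth. Qed.

Lemma smooth_bend : smooth2 U (fun _ s => bend (curvature c s) (mod_torsion c s)).
Proof. unfold bend; smooth. Qed.

Lemma smooth_ratio :
  smooth2 U (fun _ s => Derive (curvature c) s / curvature c s * twist (mod_torsion c s)).
Proof. pose proof smooth_twist; smooth. Qed.

Lemma vsmooth_force mu : vsmooth2 U (fun _ s => force_vector mu c s).
Proof.
  pose proof (smooth2_ds U _ smooth_ratio) as hy.
  pose proof (smooth2_Derive_n U _ 2 smooth_twist) as hz.
  unfold ds, twist in hy, hz.
  repeat apply vsmooth2_vadd; try apply vsmooth2_vscale; try exact openU.
  - unfold force1; smooth.
  - now apply (vsmooth2_tangent U openU (fun _ => c)).
  - unfold force2; smooth.
  - now apply (vsmooth2_normal U openU (fun _ => c)).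
  - unfold force3; smooth.
  - now apply (vsmooth2_binormal U openU (fun _ => c)).
Qed.

Lemma vsmooth_momentum1 : vsmooth2 U (fun _ s => momentum1 c s).
Proof.
  pose proof (smooth2_ds U _ smooth_twist) as hz; unfold ds in hz.
  pose proof smooth_ratio; pose proof smooth_bend.
  apply vsmooth2_vadd; try apply vsmooth2_vscale; try exact openU.
  - assumption.
  - now apply (vsmooth2_normal U openU (fun _ => c)).
  - smooth.
  - now apply (vsmooth2_binormal U openU (fun _ => c)).
Qed.

Lemma vsmooth_momentum2 : vsmooth2 U (fun _ s => momentum2 c s).
Proof.
  pose proof smooth_twist; apply vsmooth2_vscale; try exact openU; [smooth|].
  now apply (vsmooth2_binormal U openU (fun _ => c)).
Qed.

Variable V : R -> vec.
Hypothesis smooth_V : vsmooth2 U (fun _ => V).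

Lemma smooth_potential mu : smooth2 U (fun _ s => potential mu c V s).
Proof.
  unfold potential; apply smooth2_minus; try exact openU.
  - apply smooth2_plus; try exact openU; apply smooth2_dot; try exact openU.
    + exact vsmooth_momentum1.
    + exact (vsmooth2_curve_deriv U _ 1 smooth_V).
    + exact vsmooth_momentum2.
    + exact (vsmooth2_curve_deriv U _ 2 smooth_V).
  - apply smooth2_mult; try exact openU; [now apply smooth2_const|].
    apply smooth2_dot; try exact openU; [exact (vsmooth_force mu)|exact smooth_V].
Qed.

(** The product rule, with N' and B' taken from the Frenet equations; [lagrangian_diff_frenet]
    recognizes the terms containing V', V'' and V'''. The derivative of the force vector stays
    symbolic, as it only multiplies V. *)
Lemma is_derive_potential mu s : I s -> frenet_at c s ->
  is_derive (potential mu c V) s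
    (lagrangian_diff mu (curvature c s) (mod_torsion c s)
       (curve_deriv 1 c s) (curve_deriv 2 c s) (curve_deriv 3 c s)
       (curve_deriv 1 V s) (curve_deriv 2 V s) (curve_deriv 3 V s)
     - 2 * dot (curve_deriv 1 (force_vector mu c) s) (V s)).
Proof.
  intros h fr.
  set (tw := fun r : R => twist (mod_torsion c r)).
  set (ratio := fun r : R => Derive (curvature c) r / curvature c r * tw r).
  assert (dk : is_derive (curvature c) s (Derive (curvature c) s))
    by exact (Derive_correct _ _ (smooth2_ex_derive_s U _ 0 s smooth_k h)).
  assert (dl : is_derive (mod_torsion c) s (Derive (mod_torsion c) s))
    by exact (Derive_correct _ _ (smooth2_ex_derive_s U _ 0 s smooth_l h)).
  assert (dy : is_derive ratio s (Derive ratio s))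
    by exact (Derive_correct _ _ (smooth2_ex_derive_s U _ 0 s smooth_ratio h)).
  assert (dz : is_derive (Derive tw) s (Derive_n tw 2 s))
    by exact (Derive_correct _ _
         (smooth2_ex_derive_s U _ 0 s (smooth2_ds U _ smooth_twist) h)).
  assert (dm : is_derive (fun r => -2 * (ratio r + Derive tw r)) s
                 (-2 * (Derive ratio s + Derive_n tw 2 s)))
    by exact (is_derive_scal _ s (-2) _ (is_derive_plus _ _ s _ _ dy dz)).
  pose proof (is_derive_twist _ _ _ dl) as dtw; cbv beta in dtw.
  pose proof (is_derive_bend _ _ _ _ _ dk dl) as dbe; cbv beta in dbe.
  pose proof (is_vderive_vadd _ _ s _ _
    (is_vderive_vscale _ _ s _ _ dbe (fr_normal c s fr))
    (is_vderive_vscale _ _ s _ _ dm (fr_binormal c s fr))) as dM1.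
  pose proof (is_vderive_vscale _ _ s _ _ (is_derive_scal _ s 2 _ dtw)
    (fr_binormal c s fr)) as dM2.
  assert (dF : is_vderive (force_vector mu c) s (curve_deriv 1 (force_vector mu c) s))
    by exact (vsmooth2_is_vderive_s U _ 0 0 s (vsmooth_force mu) h).
  assert (dV0 : is_vderive V s (curve_deriv 1 V s))
    by exact (vsmooth2_is_vderive_s U _ 0 0 s smooth_V h).
  pose proof (vsmooth2_is_vderive_s U _ 1 0 s smooth_V h) as dV1.
  pose proof (vsmooth2_is_vderive_s U _ 2 0 s smooth_V h) as dV2.
  pose proof (is_derive_minus _ _ s _ _
    (is_derive_plus _ _ s _ _ (is_derive_dot _ _ s _ _ dM1 dV1)
       (is_derive_dot _ _ s _ _ dM2 dV2))
    (is_derive_scal _ s 2 _ (is_derive_dot _ _ s _ _ dF dV0))) as D.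
  refine (is_derive_eq _ _ _ _ D _); clear D.
  rewrite (fr_d1 c s fr), (fr_d2 c s fr), (fr_d3 c s fr).
  rewrite (lagrangian_diff_frenet mu (curvature c s) (Derive (curvature c) s)
    (mod_torsion c s) (Derive (mod_torsion c) s)
    (Derive ratio s) (Derive_n tw 2 s)
    _ _ _ _ _ _ (fr_curvature_pos c s fr) (fr_TN c s fr) (fr_NB c s fr) (fr_BT c s fr)).
  assert (etw : Derive tw s = twist_diff (mod_torsion c s) (Derive (mod_torsion c) s))
    by exact (is_derive_unique _ _ _ dtw).
  change (minus ?a ?b) with (a - b); change (plus ?a ?b) with (a + b).
  match goal with |- _ = _ - 2 * dot ?v _ - _ => change v with (force_vector mu c s) end.
  change (twist (mod_torsion c s)) with (tw s).
  change (Derive (curvature c) s / curvature c s * tw s) with (ratio s).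
  rewrite etw; ring.
Qed.

End Potential.

(** * First variation *)

Lemma curve_deriv_ext_loc (F G : curve) k s :
  locally s (fun r => F r = G r) -> curve_deriv k F s = curve_deriv k G s.
Proof.
  intros h; apply vec_ext; apply Derive_n_ext_loc;
    revert h; apply filter_imp; now intros r ->.
Qed.

Lemma curve_deriv_vzero (V : curve) k s :
  locally s (fun r => V r = vzero) -> curve_deriv k V s = vzero.
Proof.
  intros h; rewrite (curve_deriv_ext_loc V (fun _ => vzero)) by easy.
  unfold curve_deriv, vzero, cx, cy, cz; cbn [fst snd].
  destruct k; [easy|]; now rewrite Derive_n_const.
Qed.

Lemma locally_between (a b s : R) : a < s < b -> locally s (fun r => a < r < b).
Proof. exact (open2_locally_s _ 0 s (open2_between a b)). Qed.

Lemma continuous_eq_0 (f : R -> R) x : continuous f x ->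
  (forall eps, 0 < eps -> exists y, Rabs (y - x) < eps /\ f y = 0) -> f x = 0.
Proof.
  intros hf h; destruct (Req_dec (f x) 0) as [e|ne]; [easy|exfalso].
  assert (hp : 0 < Rabs (f x)) by now apply Rabs_pos_lt.
  destruct (proj1 (filterlim_locally _ _) hf (mkposreal _ hp)) as [d hd].
  destruct (h d (cond_pos d)) as (y & hy & ey).
  specialize (hd y hy); change (Rabs (f y - f x) < Rabs (f x)) in hd.
  rewrite ey, Rminus_0_l, Rabs_Ropp in hd; lra.
Qed.

Lemma zero_derive_constant (f : R -> R) L :
  (forall s, 0 <= s <= L -> continuity_pt f s) ->
  (forall s, 0 < s < L -> is_derive f s 0) ->
  forall s, 0 <= s <= L -> f s = f 0.
Proof.
  intros hc hd s hs.
  destruct (MVT_gen f 0 s (fun _ => 0)) as (y & _ & e).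
  - rewrite Rmin_left, Rmax_right by lra; intros; apply hd; lra.
  - rewrite Rmin_left, Rmax_right by lra; intros; apply hc; lra.
  - lra.
Qed.

(** Uniform continuity along the compact segment at t = 0, with tolerance 1, keeps f(t, s) within 1
    of its value 1. Normalizing that value lets one tolerance serve all s. *)
Lemma positive_near_0 (f : R -> R -> R) L :
  (forall s, 0 <= s <= L -> continuity_2d_pt f 0 s) ->
  (forall s, 0 <= s <= L -> f 0 s = 1) ->
  exists d, 0 < d /\ forall t s, Rabs t < d -> 0 <= s <= L -> 0 < f t s.
Proof.
  intros hc h1.
  destruct (uniform_continuity_2d_1d' f 0 L 0 hc (mkposreal 1 Rlt_0_1)) as [d hd].
  exists d; split; [apply cond_pos|intros t s ht hs].
  pose proof (cond_pos d) as hp; apply Rabs_def2 in ht.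
  specialize (hd s 0 s t hs ltac:(lra) hs ltac:(lra)).
  rewrite Rminus_diag, Rabs_R0 in hd; specialize (hd hp).
  rewrite h1 in hd by easy; simpl in hd; apply Rabs_def2 in hd; lra.
Qed.

Lemma frenet_positive c s : curve_deriv 1 c s <> vzero -> curvature c s <> 0 ->
  0 < speed2 c s /\ 0 < wedge2 c s.
Proof.
  intros h1 h2; split; [now apply dot_self_gt_0|].
  destruct (dot_self_ge_0 (wedge c s)) as [h|h]; [easy|].
  elim h2; unfold curvature, vnorm; fold (wedge c s); rewrite <- h, sqrt_0.
  unfold Rdiv; ring.
Qed.

Lemma positive_frenet c s : 0 < speed2 c s -> 0 < wedge2 c s ->
  curve_deriv 1 c s <> vzero /\ curvature c s <> 0.
Proof.
  intros h1 h2; split.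
  - intros e; unfold speed2 in h1; rewrite e in h1.
    unfold dot, vzero, cx, cy, cz in h1; simpl in h1; lra.
  (* The claim concerns the single point s, so the domain is taken to be that point. *)
  - refine (curvature_neq_0 (fun _ r => r = s) (fun _ => c) _ _ 0 s eq_refl);
      now intros t r ->.
Qed.

Lemma smooth_curve_vsmooth2 L c : smooth_curve L c ->
  exists e, 0 < e /\ vsmooth2 (fun _ s => - e < s < L + e) (fun _ => c).
Proof.
  intros (e & he & h); exists e; split; [easy|].
  split; [|split]; apply smooth2_static; try apply open2_between;
    intros n s hs; apply (h n s hs).
Qed.

(** A Frenet curve is nondegenerate on [0,L] by definition; this openness carries the property to a
    neighbourhood, where inverses and roots stay smooth and two-sided derivatives at 0 and L make
    sense. *)
Lemma open2_nondegenerate U (G : R -> curve) : open2 U -> vsmooth2 U G ->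
  open2 (fun t s => U t s /\ 0 < speed2 (G t) s /\ 0 < wedge2 (G t) s).
Proof.
  intros oU hG t s (h & h1 & h2); repeat apply locally_2d_and.
  - now apply oU.
  - generalize (open2_gt_0 U _ oU (fun t s => smooth2_continuity U _ t s
      (smooth2_speed2 U oU G hG)) t s (conj h h1)).
    apply locally_2d_impl, locally_2d_forall; tauto.
  - generalize (open2_gt_0 U _ oU (fun t s => smooth2_continuity U _ t s
      (smooth2_wedge2 U oU G hG)) t s (conj h h2)).
    apply locally_2d_impl, locally_2d_forall; tauto.
Qed.

Section Strip.

Variables (mu L : R) (c : curve).
Hypothesis hL : 0 < L.
Hypothesis hfrenet : frenet_curve L c.
Hypothesis harc : arclength_parametrized L c.

Lemma frenet_domain : exists I : R -> Prop,
  open2 (fun _ s => I s) /\ vsmooth2 (fun _ s => I s) (fun _ => c) /\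
  (forall s, I s -> 0 < speed2 c s) /\ (forall s, I s -> 0 < wedge2 c s) /\
  (forall s, 0 <= s <= L -> I s).
Proof.
  destruct hfrenet as (hs & hn), (smooth_curve_vsmooth2 L c hs) as (e & he & hc).
  exists (fun s => - e < s < L + e /\ 0 < speed2 c s /\ 0 < wedge2 c s).
  split; [|split; [|split; [|split]]]; try tauto.
  - exact (open2_nondegenerate _ _ (open2_between _ _) hc).
  - revert hc; apply vsmooth2_sub; tauto.
  - intros s h; split; [lra|]; now apply frenet_positive; apply hn.
Qed.

(** Arclength parametrization is assumed on [0,L] only, so |c'| = 1 can be differentiated in the
    open interval. *)
Lemma interior_frenet s : 0 < s < L -> frenet_at c s.
Proof.
  destruct frenet_domain as (I & oI & hc & hp & hq & hI).
  apply (unit_speed_frenet (fun s => 0 < s < L)).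
  - apply open2_between.
  - revert hc; apply vsmooth2_sub; intros _ r h; apply hI; lra.
  - intros r h; apply harc; lra.
  - intros r h; apply hq, hI; lra.
Qed.

Section Variation.

Variables (G : R -> curve) (d : R).
Hypothesis hd : 0 < d.
Hypothesis smoothG : smooth_family d L G.
Hypothesis frenetG : forall t, Rabs t < d -> frenet_curve L (G t).
Hypothesis startG : forall s, 0 <= s <= L -> G 0 s = c s.

Lemma variation_domain : exists U : R -> R -> Prop,
  open2 U /\ vsmooth2 U G /\
  (forall t s, U t s -> 0 < speed2 (G t) s) /\ (forall t s, U t s -> 0 < wedge2 (G t) s) /\
  (forall t s, Rabs t < d -> 0 <= s <= L -> U t s).
Proof.
  destruct smoothG as (e & he & h).
  assert (oU : open2 (fun t s => Rabs t < d /\ - e < s < L + e)).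
  { exact (open2_and _ _ (open2_abs_lt d) (open2_between _ _)). }
  assert (hG : vsmooth2 (fun t s => Rabs t < d /\ - e < s < L + e) G).
  { split; [|split]; intros n t s (h1 & h2); apply (h n t s h1 h2). }
  exists (fun t s => (Rabs t < d /\ - e < s < L + e)
                     /\ 0 < speed2 (G t) s /\ 0 < wedge2 (G t) s).
  split; [|split; [|split; [|split]]]; try tauto.
  - exact (open2_nondegenerate _ _ oU hG).
  - revert hG; apply vsmooth2_sub; tauto.
  - intros t s ht hs; split; [split; [easy|lra]|].
    now apply frenet_positive; apply (frenetG t ht).
Qed.

Lemma variation_integrand s : 0 < s < L ->
  is_derive (fun t => integrand mu (G t) s) 0
    (lagrangian_diff mu (curvature c s) (mod_torsion c s)
       (curve_deriv 1 c s) (curve_deriv 2 c s) (curve_deriv 3 c s)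
       (curve_deriv 1 (velocity G 0) s) (curve_deriv 2 (velocity G 0) s)
       (curve_deriv 3 (velocity G 0) s)).
Proof.
  intros h; destruct variation_domain as (U & oU & hG & hp & hq & hU).
  assert (hU0 : U 0 s) by (apply hU; [rewrite Rabs_R0; easy|lra]).
  pose proof (interior_frenet s h) as fr.
  (* [G 0] agrees with [c] on [0,L], hence near each interior point, and there the derivatives agree
     as well. *)
  assert (e : forall k, curve_deriv k (G 0) s = curve_deriv k c s).
  { intros k; apply curve_deriv_ext_loc; generalize (locally_between 0 L s h).
    apply filter_imp; intros r hr; apply startG; lra. }
  pose proof (fun k => vsmooth2_is_vderive_t U oU G k 0 s hG hU0) as D.
  pose proof (is_vderive_cross _ _ _ _ _ (D 1%nat) (D 2%nat)) as Dw.
  pose proof (is_derive_dot _ _ _ _ _ (D 1%nat) (D 1%nat)) as Dp.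
  pose proof (is_derive_dot _ _ _ _ _ Dw Dw) as Dq.
  pose proof (is_derive_dot _ _ _ _ _ Dw (D 3%nat)) as Dv.
  cbv beta in Dp, Dq, Dv.
  apply is_derive_ext_loc with
    (fun t => lagrangian mu (speed2 (G t) s) (wedge2 (G t) s) (volume (G t) s)).
  { generalize (open2_locally_t U 0 s oU hU0); apply filter_imp.
    intros t ht; symmetry; apply integrand_lagrangian; auto. }
  eapply is_derive_eq.
  - apply (is_derive_lagrangian mu _ _ _ 0 _ _ _ (curvature c s) (mod_torsion c s) Dp Dq Dv).
    + rewrite <- (fr_speed2 c s fr); unfold speed2; now rewrite e.
    + rewrite <- (fr_wedge2 c s fr); unfold wedge2, wedge; now rewrite !e.
    + rewrite <- (fr_volume c s fr); unfold volume, wedge; now rewrite !e.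
    + exact (fr_curvature_pos c s fr).
  - unfold lagrangian_diff; rewrite (e 1%nat), (e 2%nat), (e 3%nat).
    rewrite (dot_comm (curve_deriv 1 (velocity G 0) s)),
      (dot_comm _ (cross (curve_deriv 1 c s) (curve_deriv 2 c s))).
    ring.
Qed.

Variable eta : R.
Hypothesis heta : 0 < eta.
Hypothesis fixedG : forall t s,
  Rabs t < d -> 0 <= s <= L -> s <= eta \/ L - eta <= s -> G t s = c s.

Lemma velocity_end s : 0 <= s <= L -> s <= eta \/ L - eta <= s -> velocity G 0 s = vzero.
Proof.
  intros h1 h2.
  assert (H : locally 0 (fun t => G t s = c s)).
  { exists (mkposreal d hd); intros t ht; apply fixedG; try easy.
    change (Rabs (t - 0) < d) in ht; now rewrite Rminus_0_r in ht. }
  apply vec_ext.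
  - refine (eq_trans (Derive_ext_loc _ (fun _ => cx (c s)) 0 _) (Derive_const _ 0)).
    revert H; apply filter_imp; now intros t ->.
  - refine (eq_trans (Derive_ext_loc _ (fun _ => cy (c s)) 0 _) (Derive_const _ 0)).
    revert H; apply filter_imp; now intros t ->.
  - refine (eq_trans (Derive_ext_loc _ (fun _ => cz (c s)) 0 _) (Derive_const _ 0)).
    revert H; apply filter_imp; now intros t ->.
Qed.

(** Near an interior point of a collar the velocity is identically zero, so its derivatives vanish
    too. The end points are excluded because the velocity is not controlled outside [0,L]. *)
Lemma potential_end s : 0 < s < L -> s < eta \/ L - eta < s ->
  potential mu c (velocity G 0) s = 0.
Proof.
  intros h1 h2.
  assert (H : locally s (fun r => velocity G 0 r = vzero)).
  { destruct h2 as [h2|h2].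
    - generalize (filter_and _ _ (locally_between 0 L s h1) (locally_between 0 eta s ltac:(lra))).
      apply filter_imp; intros r hr; apply velocity_end; lra.
    - generalize (filter_and _ _ (locally_between 0 L s h1)
                    (locally_between (L - eta) L s ltac:(lra))).
      apply filter_imp; intros r hr; apply velocity_end; lra. }
  unfold potential; rewrite (curve_deriv_vzero _ 1 s H), (curve_deriv_vzero _ 2 s H).
  rewrite velocity_end by lra; unfold dot, vzero, cx, cy, cz; simpl; ring.
Qed.

Lemma first_variation_of_family :
  is_derive (fun t => sadowsky mu L (G t)) 0
    (RInt (fun s => 2 * dot (curve_deriv 1 (force_vector mu c) s) (velocity G 0 s)) 0 L).
Proof.
  destruct variation_domain as (U & oU & hG & hp & hq & hU).
  destruct frenet_domain as (I & oI & hc & hp' & hq' & hI).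
  set (V := velocity G 0) in *.
  set (g := fun s => 2 * dot (curve_deriv 1 (force_vector mu c) s) (V s)).
  assert (h0 : Rabs 0 < d) by (rewrite Rabs_R0; easy).
  (* Both the curve and the velocity at time 0 are smooth on [K], an open set containing [0,L]. *)
  set (K := fun s => I s /\ U 0 s).
  assert (oK : open2 (fun _ s => K s)).
  { intros t s (k1 & k2); apply locally_2d_and; [now apply (oI t s)|].
    destruct (oU 0 s k2) as [r hr]; exists r; intros u v _ hv; apply hr; [|easy].
    rewrite Rminus_diag, Rabs_R0; apply cond_pos. }
  assert (hK : forall s, 0 <= s <= L -> K s) by (split; auto).
  assert (cK : vsmooth2 (fun _ s => K s) (fun _ => c)).
  { revert hc; apply vsmooth2_sub; intros _ s (k1 & _); exact k1. }
  assert (VK : vsmooth2 (fun _ s => K s) (fun _ => V)).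
  { apply (vsmooth2_at_time U K (velocity G) 0 oK); [intros s (_ & k2); easy|].
    now apply vsmooth2_velocity. }
  assert (pK : forall s, K s -> 0 < speed2 c s) by (intros s (k1 & _); auto).
  assert (qK : forall s, K s -> 0 < wedge2 c s) by (intros s (k1 & _); auto).
  pose proof (smooth_potential K oK c cK pK qK V VK mu) as sP.
  assert (sg : smooth2 (fun _ s => K s) (fun _ => g)).
  { apply (smooth2_mult _ oK (fun _ _ => 2)); [now apply smooth2_const|].
    apply smooth2_dot; [easy| |easy].
    apply (vsmooth2_curve_deriv _ (fun _ => force_vector mu c) 1).
    exact (vsmooth_force K oK c cK pK qK mu). }
  assert (cont : forall f, smooth2 (fun _ s => K s) (fun _ => f) ->
            forall s, 0 <= s <= L -> continuous f s).
  { intros f hf s hs; apply (ex_derive_continuous f).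
    exact (smooth2_ex_derive_s _ _ 0 s hf (hK s hs)). }
  pose proof (smooth2_integrand U oU G hG hp hq mu) as sF.
  assert (E : RInt (fun s => Derive (fun t => integrand mu (G t) s) 0) 0 L = RInt g 0 L).
  (* The splitting into a total derivative and 2 b'.V is proved at interior points, which is all
     that equality of integrals asks for. *)
  { transitivity (RInt (fun s => plus (Derive (potential mu c V) s) (g s)) 0 L).
    - apply RInt_ext; rewrite Rmin_left, Rmax_right by lra; intros s hs.
      refine (eq_trans (is_derive_unique _ _ _ (variation_integrand s hs)) _).
      rewrite (is_derive_unique (potential mu c V) _ _ (is_derive_potential K oK c cK pK qK
        V VK mu s (hK s ltac:(lra)) (interior_frenet s hs))).
      unfold g, plus; simpl; fold V; ring.
    - assert (c0 : forall s, Rmin 0 L <= s <= Rmax 0 L ->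
                continuous (Derive (potential mu c V)) s).
      { rewrite Rmin_left, Rmax_right by lra; apply cont.
        exact (smooth2_ds _ _ sP). }
      refine (eq_trans (RInt_plus (V := R_CompleteNormedModule) _ _ 0 L _ _) _).
      + apply (ex_RInt_continuous (V := R_CompleteNormedModule)); exact c0.
      + apply (ex_RInt_continuous (V := R_CompleteNormedModule)).
        rewrite Rmin_left, Rmax_right by lra; now apply cont.
      + rewrite RInt_Derive; [|intros s|exact c0].
        (* The potential vanishes in the open collars and is continuous up to the ends, so it
           vanishes at 0 and L. The witness [y] is less than [eps], [eta] and [L], so [y] and
           [L - y] are interior points of the collars. *)
        * assert (Z : forall x, x = 0 \/ x = L -> potential mu c V x = 0).
          { intros x hx; apply continuous_eq_0; [apply cont; [easy|lra]|intros eps heps].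
            set (y := Rmin eps (Rmin eta L) / 2).
            assert (hy : 0 < y < eps /\ y < eta /\ y < L).
            { unfold y; pose proof (Rmin_l eps (Rmin eta L));
                pose proof (Rmin_r eps (Rmin eta L)); pose proof (Rmin_l eta L);
                pose proof (Rmin_r eta L).
              assert (0 < Rmin eps (Rmin eta L)) by (repeat apply Rmin_glb_lt; lra); lra. }
            destruct hx as [-> | ->].
            - exists y; split; [rewrite Rminus_0_r, Rabs_right; lra|].
              apply potential_end; lra.
            - exists (L - y); split; [rewrite Rabs_left; lra|].
              apply potential_end; lra. }
          rewrite !Z by tauto; rewrite Rminus_0_r; apply Rplus_0_l.
        * rewrite Rmin_left, Rmax_right by lra; intros hs.
          exact (smooth2_ex_derive_s _ _ 0 s sP (hK s hs)). }
  rewrite <- E.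
  assert (ld : locally 0 (fun t => Rabs t < d)).
  { exists (mkposreal d hd); intros t ht.
    change (Rabs (t - 0) < d) in ht; now rewrite Rminus_0_r in ht. }
  (* Differentiation under the integral sign; the joint smoothness of the integrand on [U] supplies
     the three side conditions. *)
  apply (is_derive_RInt_param (fun t s => integrand mu (G t) s)).
  - revert ld; apply filter_imp; intros t ht s.
    rewrite Rmin_left, Rmax_right by lra; intros hs.
    exact (smooth2_ex_derive_t U _ t s sF (hU t s ht hs)).
  - intros s; rewrite Rmin_left, Rmax_right by lra; intros hs.
    exact (smooth2_continuity U _ 0 s (smooth2_dt U _ sF) (hU 0 s h0 hs)).
  - revert ld; apply filter_imp; intros t ht.
    apply (ex_RInt_continuous (V := R_CompleteNormedModule)).
    rewrite Rmin_left, Rmax_right by lra; intros s hs.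
    apply (ex_derive_continuous (fun s => integrand mu (G t) s)).
    exact (smooth2_ex_derive_s U _ t s sF (hU t s ht hs)).
Qed.

End Variation.

Lemma first_variation G : proper_variation L c G ->
  is_derive (fun t => sadowsky mu L (G t)) 0
    (RInt (fun s => 2 * dot (curve_deriv 1 (force_vector mu c) s) (velocity G 0 s)) 0 L).
Proof.
  intros (d & hd & hs & hf & h0 & eta & heta & hfix).
  now apply first_variation_of_family with d eta.
Qed.

End Strip.

(** * Bump variations *)

(** Nothing is known about the sign of [h] outside (a,b), where the bump is zero; the integral is
    cut at a and b accordingly. *)
Lemma RInt_bump_gt_0 (h : R -> R) a b L :
  0 < a -> a < b -> b < L ->
  (forall s, a < s < b -> 0 < h s) -> (forall s, 0 <= s <= L -> continuous h s) ->
  0 < RInt (fun s => bump a b s * h s) 0 L.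
Proof.
  intros ha hab hb hpos hc; set (g := fun s => bump a b s * h s).
  assert (cg : forall s, 0 <= s <= L -> continuous g s).
  { intros s hs; apply (continuous_mult (bump a b) h); [|auto].
    apply (ex_derive_continuous (bump a b)).
    exact (smooth2_ex_derive_s _ _ 0 s (smooth2_bump a b) Logic.I). }
  assert (ig : forall x y, 0 <= x <= L -> 0 <= y <= L -> ex_RInt g x y).
  { intros x y hx hy; apply (ex_RInt_continuous (V := R_CompleteNormedModule)).
    intros s hs; apply cg; revert hs; unfold Rmin, Rmax; destruct (Rle_dec x y); lra. }
  assert (z : forall x y, x <= y -> y <= a \/ b <= x -> RInt g x y = 0).
  { intros x y hxy hy; transitivity (RInt (fun _ => 0) x y).
    - apply RInt_ext; rewrite Rmin_left, Rmax_right by lra; intros s hs.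
      unfold g; rewrite bump_eq_0 by lra; apply Rmult_0_l.
    - rewrite RInt_const; apply Rmult_0_r. }
  rewrite <- (RInt_Chasles g 0 a L), <- (RInt_Chasles g a b L) by (apply ig; lra).
  rewrite (z 0 a), (z b L) by lra; unfold plus; simpl.
  assert (0 < RInt g a b); [|lra].
  apply RInt_gt_0; [easy| |intros s hs; apply cg; lra].
  intros s hs; apply Rmult_lt_0_compat; [now apply bump_gt_0|auto].
Qed.

Section LinearVariation.

Variables (L : R) (c : curve) (w : vec) (a b : R).
Hypothesis hfrenet : frenet_curve L c.
Hypothesis ha : 0 < a.
Hypothesis hb : b < L.

Definition bump_variation (t s : R) : vec := vadd (c s) (vscale (t * bump a b s) w).

Lemma velocity_bump_variation s : velocity bump_variation 0 s = vscale (bump a b s) w.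
Proof.
  assert (H : forall p q r, Derive (fun z : R => p + z * q * r) 0 = q * r).
  { intros p q r; apply is_derive_unique; auto_derive; [easy|ring]. }
  apply vec_ext; apply H.
Qed.

Lemma bump_variation_0 s : bump_variation 0 s = c s.
Proof. apply vec_ext; unfold bump_variation; vec_ring. Qed.

Lemma bump_variation_end t s : s <= a \/ b <= s -> bump_variation t s = c s.
Proof.
  intros h; unfold bump_variation; rewrite bump_eq_0 by easy.
  apply vec_ext; vec_ring.
Qed.

Lemma vsmooth2_bump_variation (I : R -> Prop) :
  open2 (fun _ s => I s) -> vsmooth2 (fun _ s => I s) (fun _ => c) ->
  vsmooth2 (fun _ s => I s) bump_variation.
Proof.
  intros oI hc; apply vsmooth2_vadd; [easy..|].
  apply vsmooth2_vscale; [easy| |now apply vsmooth2_const].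
  apply smooth2_mult; [easy|now apply smooth2_time|].
  apply (smooth2_sub (fun _ _ => True)); [easy|apply smooth2_bump].
Qed.

(** The clause with content is that all curves with small t are Frenet: squared speed and squared
    wedge must stay positive uniformly in s. *)
Lemma proper_bump_variation : proper_variation L c bump_variation.
Proof.
  destruct hfrenet as (hs & hn), (smooth_curve_vsmooth2 L c hs) as (e & he & hc).
  set (U := fun _ s : R => - e < s < L + e) in *.
  assert (oI : open2 U) by apply open2_between.
  assert (hG : vsmooth2 U bump_variation) by exact (vsmooth2_bump_variation _ oI hc).
  assert (dom : forall s, 0 <= s <= L -> U 0 s) by (intros; unfold U; lra).
  assert (pos : forall f : curve -> R -> R,
    smooth2 U (fun t s => f (bump_variation t) s) ->
    (forall s, 0 <= s <= L -> 0 < f (bump_variation 0) s) ->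
    exists d, 0 < d /\
      forall t s, Rabs t < d -> 0 <= s <= L -> 0 < f (bump_variation t) s).
  { intros f hf h0.
    (* Dividing by the value at t = 0 produces a function equal to 1 there, as [positive_near_0]
       requires. *)
    destruct (positive_near_0
      (fun t s => f (bump_variation t) s * / f (bump_variation 0) s) L) as (d & hd & h).
    - intros s hs'; pose proof (h0 s hs').
      apply continuity_2d_pt_mult; [exact (smooth2_continuity U _ 0 s hf (dom s hs'))|].
      apply continuity_2d_pt_inv; [|lra].
      refine (smooth2_continuity U (fun _ s => f (bump_variation 0) s) 0 s _ (dom s hs')).
      exact (smooth2_at_time U (U 0) _ 0 oI (fun s k => k) hf).
    - intros s hs'; pose proof (h0 s hs'); field; lra.
    - exists d; split; [easy|intros t s ht hs'].
      specialize (h t s ht hs'); pose proof (h0 s hs') as h1.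
      apply Rmult_lt_compat_r with (r := f (bump_variation 0) s) in h; [|easy].
      rewrite Rmult_assoc, Rinv_l in h; lra. }
  assert (e0 : forall k s, curve_deriv k (bump_variation 0) s = curve_deriv k c s).
  { intros k s; apply curve_deriv_ext_loc, filter_forall, bump_variation_0. }
  destruct (pos speed2) as (d1 & hd1 & p1).
  { exact (smooth2_speed2 _ oI _ hG). }
  { intros s h; unfold speed2; rewrite e0; now apply frenet_positive; apply hn. }
  destruct (pos wedge2) as (d2 & hd2 & p2).
  { exact (smooth2_wedge2 _ oI _ hG). }
  { intros s h; unfold wedge2, wedge; rewrite (e0 1%nat), (e0 2%nat).
    now apply frenet_positive; apply hn. }
  exists (Rmin d1 d2); split; [now apply Rmin_glb_lt|split; [|split; [|split]]].
  - exists e; split; [easy|intros n t s _ h].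
    destruct hG as (g1 & g2 & g3); split; [|split];
      [exact (g1 n t s h)|exact (g2 n t s h)|exact (g3 n t s h)].
  - intros t ht; split.
    + exists e; split; [easy|intros n s h].
      destruct hG as (g1 & g2 & g3); split; [|split];
        [exact (smooth2_ex_derive_n U _ n t s g1 h)
        |exact (smooth2_ex_derive_n U _ n t s g2 h)
        |exact (smooth2_ex_derive_n U _ n t s g3 h)].
    + pose proof (Rmin_l d1 d2); pose proof (Rmin_r d1 d2).
      intros s h; apply positive_frenet; [apply p1|apply p2]; lra.
  - intros s _; apply bump_variation_0.
  (* With this width the collars lie in [0,a] and [b,L], where the bump vanishes. *)
  - exists (Rmin a (L - b)); split; [apply Rmin_glb_lt; lra|].
    pose proof (Rmin_l a (L - b)); pose proof (Rmin_r a (L - b)).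
    intros t s _ _ h1; apply bump_variation_end; lra.
Qed.

End LinearVariation.

Theorem mainTheorem1 (mu L : R) (hL : 0 < L) (gamma : R -> vec)
    (hfrenet : frenet_curve L gamma)
    (harc : arclength_parametrized L gamma) :
  elastic_strip mu L gamma <->
  exists b0 : vec, forall s : R, 0 <= s <= L -> force_vector mu gamma s = b0.
Proof.
  destruct (frenet_domain L gamma hfrenet) as (I & oI & hc & hp & hq & hI).
  pose proof (vsmooth_force I oI gamma hc hp hq mu) as hF.
  split.
  - intros hel; exists (force_vector mu gamma 0).
    assert (Z : forall s, 0 < s < L -> curve_deriv 1 (force_vector mu gamma) s = vzero).
    { intros s0 hs0; set (w := curve_deriv 1 (force_vector mu gamma) s0).
      destruct (dot_self_ge_0 w) as [hpos|e]; [exfalso|now apply dot_self_eq_0].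
      (* Varying in the fixed direction w = b'(s0) makes the first variation a weighted integral of
         h = b'.w, and h(s0) = |w|^2 is positive. *)
      set (h := fun s => dot (curve_deriv 1 (force_vector mu gamma) s) w).
      assert (sh : smooth2 (fun _ s => I s) (fun _ => h)).
      { apply smooth2_dot; [easy| |now apply vsmooth2_const].
        exact (vsmooth2_curve_deriv _ (fun _ => force_vector mu gamma) 1 hF). }
      assert (ch : forall s, 0 <= s <= L -> continuous h s).
      { intros s hs; apply (ex_derive_continuous h).
        exact (smooth2_ex_derive_s _ _ 0 s sh (hI s hs)). }
      assert (hloc : locally s0 (fun s => 0 < s < L /\ 0 < h s)).
      { apply filter_and; [now apply locally_between|].
        apply (ch s0 ltac:(lra)); exact (open_gt 0 (h s0) hpos). }
      destruct hloc as [r hr].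
      assert (hr' : forall s, s0 - r < s < s0 + r -> 0 < s < L /\ 0 < h s).
      { intros s hs; apply (hr s); apply Rabs_def1; unfold minus, plus, opp; simpl; lra. }
      pose proof (cond_pos r) as rpos.
      (* Half the radius keeps both ends of the bump strictly inside the neighbourhood, which yields
         0 < a and b < L. *)
      pose proof (hr' (s0 - r / 2) ltac:(lra)) as [ka _].
      pose proof (hr' (s0 + r / 2) ltac:(lra)) as [kb _].
      set (a := s0 - r / 2) in *; set (b := s0 + r / 2) in *.
      pose proof (proper_bump_variation L gamma w a b hfrenet ltac:(lra) ltac:(lra)) as pv.
      pose proof (is_derive_unique _ _ _ (hel _ pv)) as e1.
      rewrite (is_derive_unique _ _ _ (first_variation mu L gamma hL hfrenet harc _ pv)) in e1.
      assert (0 < RInt (fun s => bump a b s * (2 * h s)) 0 L).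
      { apply RInt_bump_gt_0; try lra.
        - unfold a, b; lra.
        - intros s hs; assert (0 < h s) by (apply hr'; unfold a, b in hs; lra); lra.
        - intros s hs; apply (continuous_mult (fun _ => 2) h); [apply continuous_const|auto]. }
      rewrite (RInt_ext _ (fun s => bump a b s * (2 * h s))) in e1; [lra|].
      intros s _; rewrite velocity_bump_variation; unfold h.
      match goal with |- ?l = ?r => change (@eq R l r) end; clear; vec_ring. }
    (* A zero derivative inside (0,L) with continuity at the ends suffices for the mean value
       theorem; it is applied to each coordinate of b. *)
    assert (C : forall f, smooth2 (fun _ s => I s) (fun _ => f) ->
              (forall s, 0 < s < L -> Derive f s = 0) ->
              forall s, 0 <= s <= L -> f s = f 0).
    { intros f hf hz; apply zero_derive_constant.
      - intros s hs; apply continuity_pt_filterlim, (ex_derive_continuous f).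
        exact (smooth2_ex_derive_s _ _ 0 s hf (hI s hs)).
      - intros s hs; rewrite <- (hz s hs); apply Derive_correct.
        exact (smooth2_ex_derive_s _ _ 0 s hf (hI s ltac:(lra))). }
    destruct hF as (f1 & f2 & f3).
    intros s hs; apply vec_ext.
    + apply (C (fun s => cx (force_vector mu gamma s)) f1); [|easy].
      intros r hr; exact (f_equal cx (Z r hr)).
    + apply (C (fun s => cy (force_vector mu gamma s)) f2); [|easy].
      intros r hr; exact (f_equal cy (Z r hr)).
    + apply (C (fun s => cz (force_vector mu gamma s)) f3); [|easy].
      intros r hr; exact (f_equal cz (Z r hr)).
  - intros (b0 & hb0) G pv.
    apply (is_derive_eq _ _ _ _ (first_variation mu L gamma hL hfrenet harc G pv)).
    transitivity (RInt (fun _ => 0) 0 L); [|rewrite RInt_const; apply Rmult_0_r].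
    apply RInt_ext; rewrite Rmin_left, Rmax_right by lra; intros s hs.
    rewrite (curve_deriv_ext_loc _ (fun _ => b0)).
    + unfold curve_deriv; rewrite !Derive_n_const.
      unfold dot, cx, cy, cz; simpl; ring.
    + generalize (locally_between 0 L s hs); apply filter_imp.
      intros r hr; apply hb0; lra.
Qed.
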